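(* Let $H$ be a bipartite graph containing a subgraph $K$ isomorphic to the complete bipartite graph $K_{s,t}$ (for some $s,t\ge 1$), and assume that each vertex $v\in V(H)$ is adjacent to a vertex of $V(K)$. Let $F$ be a graph with chromatic number $3$ that has a color-critical edge. Then $H$ is weakly $F$-Tur\'an-good, i.e., there is $n_0$ such that for every $n\ge n_0$ there is a complete bipartite graph $T$ on $n$ vertices with $\mathrm{ex}(n,H,F)=\mathcal{N}(H,T)$.
   Context: All graphs are finite and simple. For graphs $H,G$, $\mathcal{N}(H,G)$ denotes the number of subgraphs of $G$ isomorphic to $H$ (copies of $H$ in $G$). For graphs $H,F$, $\mathrm{ex}(n,H,F)$ denotes the maximum of $\mathcal{N}(H,G)$ over all $n$-vertex graphs $G$ containing no subgraph isomorphic to $F$ ($F$-free graphs). An edge of $F$ is color-critical if deleting it decreases the chromatic number of $F$. Given $F$ with $\chi(F)=r+1$, a graph $H$ is called weakly $F$-Tur\'an-good if for all sufficiently large $n$, $\mathrm{ex}(n,H,F)=\mathcal{N}(H,T)$ for some complete $r$-partite $n$-vertex graph $T$. *)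

(* Defs.v *)
From HB Require Import structures.
From mathcomp Require Import all_boot.

Set Implicit Arguments.
Unset Strict Implicit.
Unset Printing Implicit Defensive.

(* A finite simple graph with vertex type V is its set of edges, each edge being
   a two-element set of vertices. *)
Record graph (V : finType) := Graph {
  edges : {set {set V}};
  edges_card2 : [forall e in edges, #|e| == 2]
}.

HB.instance Definition _ (V : finType) := [isSub for @edges V].
HB.instance Definition _ (V : finType) := [Finite of graph V by <:].

Definition adj (V : finType) (G : graph V) (x y : V) : bool :=
  [set x; y] \in edges G.

Lemma adj_irrefl (V : finType) (G : graph V) : irreflexive (adj G).
Proof.
move=> x; apply/negP; rewrite /adj setUid => xG.
by have := forallP (edges_card2 G) [set x]; rewrite xG cards1.
Qed.

Lemma adj_sym (V : finType) (G : graph V) : symmetric (adj G).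
Proof. by move=> x y; rewrite /adj setUC. Qed.

(* A pair (W, D) of a vertex set and an edge set is a subgraph of G when D
   consists of edges of G with both ends in W; W may contain vertices that are
   isolated in the subgraph. *)
Definition is_subgraph (V : finType) (G : graph V)
    (S : {set V} * {set {set V}}) : bool :=
  (S.2 \subset edges G) && [forall e in S.2, e \subset S.1].

Definition isom_to (U V : finType) (H : graph U)
    (S : {set V} * {set {set V}}) : bool :=
  [exists f : {ffun U -> V},
    [&& injectiveb f, S.1 == f @: [set: U]
      & S.2 == [set f @: (e : {set U}) | e in edges H]]].

Definition copies (U V : finType) (H : graph U) (G : graph V) :
    {set {set V} * {set {set V}}} :=
  [set S | is_subgraph G S && isom_to H S].

Definition ncopies (U V : finType) (H : graph U) (G : graph V) : nat :=
  #|copies H G|.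

Definition is_free (U V : finType) (F : graph U) (G : graph V) : bool :=
  copies F G == set0.

(* If no n-vertex graph is F-free, this maximum is 0 by convention; that cannot
   happen when F has an edge. *)
Definition turan_ex (n : nat) (U W : finType) (H : graph U) (F : graph W) : nat :=
  \max_(G : graph 'I_n | is_free F G) ncopies H G.

Definition colorable (V : finType) (G : graph V) (k : nat) : bool :=
  [exists c : {ffun V -> 'I_k},
    [forall x, forall y, adj G x y ==> (c x != c y)]].

Lemma colorable_exists (V : finType) (G : graph V) :
  exists k, colorable G k.
Proof.
exists #|V|; apply/existsP; exists [ffun x => enum_rank x].
apply/forallP => x; apply/forallP => y; apply/implyP => xy; rewrite !ffunE.
by apply: contraTneq xy => /enum_rank_inj ->; rewrite adj_irrefl.
Qed.

Definition chi (V : finType) (G : graph V) : nat :=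
  ex_minn (colorable_exists G).

Definition bipartite (V : finType) (G : graph V) : bool := colorable G 2.

Lemma del_edge_subproof (V : finType) (G : graph V) (e : {set V}) :
  [forall d in edges G :\ e, #|d| == 2].
Proof.
apply/forall_inP => d; rewrite inE => /andP[_ dG].
exact: (forall_inP (edges_card2 G)).
Qed.

Definition del_edge (V : finType) (G : graph V) (e : {set V}) : graph V :=
  Graph (del_edge_subproof G e).

Definition color_critical (V : finType) (G : graph V) (e : {set V}) : bool :=
  (e \in edges G) && (chi (del_edge G e) < chi G).

Definition complete_bipartite_edges (s t : nat) : {set {set 'I_s + 'I_t}} :=
  [set [set inl i; inr j] | i in [set: 'I_s], j in [set: 'I_t]].

Lemma complete_bipartite_subproof (s t : nat) :
  [forall e in complete_bipartite_edges s t, #|e| == 2].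
Proof. by apply/forall_inP => e /imset2P[i j _ _ ->]; rewrite cards2. Qed.

Definition complete_bipartite (s t : nat) : graph ('I_s + 'I_t)%type :=
  Graph (complete_bipartite_subproof s t).

(* p sends a vertex to the index of its part; every part is nonempty. *)
Definition complete_multipartite (r : nat) (V : finType) (G : graph V) : Prop :=
  exists p : V -> 'I_r,
    (forall i, exists x, p x = i) /\ (forall x y, adj G x y = (p x != p y)).

Definition weakly_turan_good (U W : finType) (H : graph U) (F : graph W) :
    Prop :=
  exists2 r, chi F = r.+1 &
  exists n0, forall n, n0 <= n ->
    exists2 T : graph 'I_n,
      complete_multipartite r T & turan_ex n H F = ncopies H T.

(* Main.v *)
Require Import Defs.
From mathcomp Require Import all_boot all_order all_algebra.
From mathcomp Require Import ring lra zify.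
Set Implicit Arguments.
Unset Strict Implicit.
Unset Printing Implicit Defensive.
Import Order.TTheory GRing.Theory Num.Theory.
(** H is connected, with parts of sizes p and q, so the complete bipartite graph with parts
of sizes x and y receives x^_p y^_q + x^_q y^_p injective homomorphisms from H, which is
Q(x, y) = x^p y^q + x^q y^p up to lower order; let f(n) be the maximum of the former over
x + y = n.  Suppose G is F-free with more than f(n) injective homomorphisms.

Passing to an induced subgraph, every vertex lies in about h f(n) / n of them (h = p + q), so
all degrees are linear, and then F-freeness (F is bipartite plus one edge) bounds the number of
common neighbours of the ends of any edge by a constant.

The other vertices of H hang on K, so AM-GM gives hom(H, G) <= sum of d(a)^(q-1) d(b)^(p-1) over
ordered adjacent pairs (a, b).  Comparing with the sum of 1/d(a) + 1/d(b), which is at most n over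
the edges, yields an edge ab with n Q(d(a), d(b)) >= hom(H, G) (d(a) + d(b)), hence
d(a) + d(b) >= n - O(1).  Therefore N(a) and N(b) partition V(G) up to O(1) vertices, only O(n)
edges do not cross, and counting again only O(n) crossing pairs are missing.  As no edge lies in
many triangles, each vertex has O(1) neighbours on one of the two sides; being in h f(n) / n
copies, where Q is nearly maximal, it is adjacent to at least 3/4 of the other side.  An edge
joining two vertices of the same kind would then lie in linearly many triangles, so G is bipartite
and has at most f(n) injective homomorphisms, a contradiction. *)

Local Open Scope ring_scope.

(** * The extremal function *)

(** Homogeneous Bernoulli inequality; [k] may be negative. Each induction step multiplies by [x + k]
    and drops the nonnegative term in [k ^+ 2]. *)
Lemma bernoulli (x k : rat) m : 0 <= x -> 0 <= x + k ->
  x ^+ m.+1 + m.+1%:R * k * x ^+ m <= (x + k) ^+ m.+1.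
Proof.
move=> x0 xk0; elim: m => [|m IH]; first by rewrite !expr1 expr0; lra.
rewrite [leRHS]exprS; apply: le_trans (ler_wpM2l xk0 IH).
have xm : 0 <= x ^+ m by apply: exprn_ge0.
rewrite ![x ^+ _.+1]exprS -[m.+2]addn1 natrD.
have : 0 <= m.+1%:R * k ^+ 2 * x ^+ m.
  by apply: mulr_ge0 => //; apply: mulr_ge0; [exact: ler0n | exact: sqr_ge0].
set M := m.+1%:R; rewrite expr2 => ?; nra.
Qed.

(** Multiplies two estimates with additive errors. The errors are weighted by [a] and [b]
    themselves, for which power bounds are at hand, and no product [e * f] appears. *)
Lemma prod_ge (a b c d e f : rat) : 0 <= a -> 0 <= b -> 0 <= c -> 0 <= d ->
  0 <= e -> 0 <= f -> a <= c + e -> b <= d + f -> a * b <= c * d + a * f + b * e.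
Proof.
move=> a0 b0 c0 d0 e0 f0 ac bd.
have [h|h] := leP a c.
  have h1 : a * b <= a * (d + f) by apply: ler_wpM2l.
  have h2 : a * d <= c * d by apply: ler_wpM2r.
  have h3 : 0 <= b * e by apply: mulr_ge0.
  lra.
have h1 : a * b <= (c + e) * b by apply: ler_wpM2r.
have h2 : c * b <= c * (d + f) by apply: ler_wpM2l.
have h3 : c * f <= a * f by apply: ler_wpM2r => //; apply: ltW.
lra.
Qed.

Lemma leq_exp_ffact z k : ((z - k) ^ k.+1 <= z ^_ k.+1)%N.
Proof.
elim: k z => [|k IH] z; first by rewrite subn0 expn1 ffactn1.
case: z => [|z]; first by rewrite exp0n.
rewrite ffactSS expnS subSS; apply: leq_mul; last exact: IH.
by apply: leq_trans (leq_subr _ _) _.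
Qed.

(** If [x] is at most [D + p], its power is already of lower order. Otherwise [bernoulli] with shift
    [- (D + p)] compares it with [(z - p) ^+ p.+1], which every factor of the falling factorial
    dominates. *)
Lemma ffact_ge p D : exists2 C : rat, 0 <= C & forall n z (x : rat), (0 < n)%N ->
  0 <= x -> x <= n%:R + D%:R -> x <= z%:R + D%:R ->
  x ^+ p.+1 <= (z ^_ p.+1)%:R + C * n%:R ^+ p.
Proof.
exists (p.+1%:R * (D + p)%:R * (1 + D%:R) ^+ p).
  by rewrite !mulr_ge0 ?exprn_ge0 // ?addr_ge0 ?ler0n //.
move=> n z x n0 x0 xn xz.
have D0 : 0 <= D%:R :> rat by rewrite ler0n.
have n1 : 1 <= n%:R :> rat by rewrite ler1n.
have xp : x ^+ p <= (1 + D%:R) ^+ p * n%:R ^+ p.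
  by rewrite -exprMn lerXn2r ?nnegrE //; nra.
have E0 : 0 <= (D + p)%:R :> rat by rewrite ler0n.
have xp0 : 0 <= x ^+ p by apply: exprn_ge0.
have p1 : 1 <= p.+1%:R :> rat by rewrite ler1n.
have key : p.+1%:R * (D + p)%:R * x ^+ p <=
   p.+1%:R * (D + p)%:R * (1 + D%:R) ^+ p * n%:R ^+ p.
  by rewrite -[leRHS]mulrA ler_wpM2l // mulr_ge0 ?ler0n //.
have z0 : 0 <= (z ^_ p.+1)%:R :> rat by rewrite ler0n.
have [h|h] := leP x (D + p)%:R.
  have : x * x ^+ p <= p.+1%:R * (D + p)%:R * x ^+ p.
    by apply: ler_wpM2r => //; nra.
  by rewrite exprS; lra.
have b := @bernoulli x (- (D + p)%:R) p x0 ltac:(lra).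
have zp : x + - (D + p)%:R <= (z - p)%:R.
  have [zp|zp] := leqP p z; first by rewrite natrB // natrD; lra.
  have : z%:R < p%:R :> rat by rewrite ltr_nat.
  by rewrite natrD in h *; rewrite ler0n in z0; have := ler0n rat (z - p); lra.
have zp2 : (x + - (D + p)%:R) ^+ p.+1 <= (z ^_ p.+1)%:R.
  apply: le_trans (_ : (z - p)%:R ^+ p.+1 <= _).
    by rewrite lerXn2r ?nnegrE ?ler0n //; lra.
  by rewrite -natrX ler_nat leq_exp_ffact.
lra.
Qed.

Section Analysis.
Variables p0 q0 : nat.
Let p := p0.+1.
Let q := q0.+1.

Definition Phi x y : nat := (x ^_ p * y ^_ q + x ^_ q * y ^_ p)%N.
Definition fmax n : nat := (\max_(x < n.+1) Phi x (n - x))%N.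
Definition Q (x y : rat) : rat := x ^+ p * y ^+ q + x ^+ q * y ^+ p.

Lemma Phi_le_fmax x y : (Phi x y <= fmax (x + y))%N.
Proof.
have xn : (x < (x + y).+1)%N by rewrite ltnS leq_addr.
by apply: leq_trans (leq_bigmax (Ordinal xn)); rewrite /= addKn.
Qed.

Lemma fmax_attained n : exists2 x, (x <= n)%N & fmax n = Phi x (n - x).
Proof.
have h : (0 < #|'I_n.+1|)%N by rewrite card_ord.
have [x E] := bigop.eq_bigmax (fun x : 'I_n.+1 => Phi x (n - x)) h.
by exists x => //; rewrite -ltnS ltn_ord.
Qed.

(** Counts injections into [x.+1] points according to whether, and at which argument, the last point
    is taken. *)
Lemma ffactS_diff x k : (x.+1 ^_ k.+1 = x ^_ k.+1 + k.+1 * x ^_ k)%N.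
Proof. 
have [h|h] := leqP k x; last by rewrite !ffact_small ?muln0 //; lia.
rewrite ffactSS ffactnSr; nia.
Qed.

Lemma ffact_leM x k : (x ^_ k.+1 <= x * x ^_ k)%N.
Proof. by rewrite ffactnSr mulnC leq_mul // leq_subr. Qed.

(** Duplicate a random vertex of an optimal bipartite graph with parts [x] and [y]: with weights [x]
    and [y], the two possible enlargements are bounded by [fmax n.+1], and by [ffactS_diff] their
    average gain is at least [(p + q) / n] times the old count. *)
Lemma fmax_rec n : ((n + (p + q)) * fmax n <= n * fmax n.+1)%N.
Proof.
have [x xn ->] := fmax_attained n.
set y := (n - x)%N; have nE : n = (x + y)%N by rewrite subnKC.
have h1 : (Phi x.+1 y <= fmax n.+1)%N by rewrite nE -addSn Phi_le_fmax.
have h2 : (Phi x y.+1 <= fmax n.+1)%N by rewrite nE -addnS Phi_le_fmax.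
move: h1 h2; rewrite /Phi !ffactS_diff.
move: (fmax _) => M.
have := ffact_leM x p0; have := ffact_leM x q0.
have := ffact_leM y p0; have := ffact_leM y q0.
rewrite -/p -/q.
move: (x ^_ p) (x ^_ q) (y ^_ p) (y ^_ q) (x ^_ p0) (x ^_ q0) (y ^_ p0) (y ^_ q0).
move=> a b c d a' b' c' d' dd cc bb aa h1 h2.
rewrite {}nE -/p -/q in h1 h2 *.
have e1 := leq_mul (leqnn x) h1; have e2 := leq_mul (leqnn y) h2.
have f1 : (p * a * d <= p * (x * a') * d)%N by rewrite leq_mul ?leq_mul.
have f2 : (q * b * c <= q * (x * b') * c)%N by rewrite leq_mul ?leq_mul.
have f3 : (q * a * d <= q * a * (y * d'))%N by rewrite leq_mul ?leq_mul.
have f4 : (p * b * c <= p * b * (y * c'))%N by rewrite leq_mul ?leq_mul.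
move: (p) (q) e1 e2 f1 f2 f3 f4 => P R *.
nia.
Qed.

(** Round [x] down to an integer and give the rest of [n] to the other part: each coordinate loses
    at most [D + 1], so [ffact_ge] applies to all four powers. *)
Lemma Q_le_fmax D : exists2 C : rat, 0 <= C & forall n (x y : rat), (0 < n)%N ->
  0 <= x -> 0 <= y -> x + y <= n%:R + D%:R ->
  Q x y <= (fmax n)%:R + C * n%:R ^+ (p0 + q0).+1.
Proof.
have [Cp Cp0 hp] := ffact_ge p0 D.+1; have [Cq Cq0 hq] := ffact_ge q0 D.+1.
set E : rat := 2 + D%:R.
have E0 : 0 <= E by rewrite addr_ge0 ?ler0n.
exists (2 * (E ^+ p * Cq + E ^+ q * Cp)).
  by rewrite mulr_ge0 // addr_ge0 // mulr_ge0 // exprn_ge0.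
move=> n x y n0 x0 y0 xyn.
(* The cap at [n] keeps the natural subtraction in [y'] exact. *)
pose x' := minn (Num.truncn x) n; pose y' := (n - x')%N.
have /andP[t1 t2] := truncn_itv x0.
have n1 : 1 <= n%:R :> rat by rewrite ler1n.
have D0 : 0 <= D%:R :> rat by rewrite ler0n.
have [xx yy] : x <= x'%:R + D.+1%:R /\ y <= y'%:R + D.+1%:R.
  rewrite -[D.+1]addn1 /y' natrB ?geq_minr // natrD /x'.
  have [h|h] := leqP (Num.truncn x) n; rewrite ?(minn_idPl h) ?(minn_idPr (ltnW h)).
    by move: t2; rewrite -[in X in X -> _]addn1 natrD => t2; split; lra.
  have : n%:R <= x by apply: le_trans t1; rewrite ler_nat ltnW.
  by split; lra.
have DS : D.+1%:R = D%:R + 1 :> rat by rewrite -[D.+1]addn1 natrD.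
have xn : x <= n%:R + D.+1%:R by rewrite DS; lra.
have yn : y <= n%:R + D.+1%:R by rewrite DS; lra.
have xE : x <= E * n%:R by rewrite /E; nra.
have yE : y <= E * n%:R by rewrite /E; nra.
have bd (z : rat) k : 0 <= z -> z <= E * n%:R -> z ^+ k <= E ^+ k * n%:R ^+ k.
  by move=> z0 zn; rewrite -exprMn lerXn2r ?nnegrE // mulr_ge0 //; lra.
have Cn0 C k : 0 <= C -> 0 <= C * n%:R ^+ k :> rat.
  by move=> C0; rewrite mulr_ge0 // exprn_ge0 ?ler0n //.
have term a b z w : 0 <= z -> 0 <= w -> z <= E * n%:R -> w <= E * n%:R ->
   z ^+ p <= a%:R + Cp * n%:R ^+ p0 -> w ^+ q <= b%:R + Cq * n%:R ^+ q0 ->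
   z ^+ p * w ^+ q <= (a * b)%:R + (E ^+ p * Cq + E ^+ q * Cp) * n%:R ^+ (p0 + q0).+1.
  move=> z0 w0 zn wn h1 h2.
  have := prod_ge (exprn_ge0 p z0) (exprn_ge0 q w0) (ler0n _ _) (ler0n _ _)
    (Cn0 _ _ Cp0) (Cn0 _ _ Cq0) h1 h2.
  have k1 := ler_wpM2r (Cn0 _ q0 Cq0) (bd _ p z0 zn).
  have k2 := ler_wpM2r (Cn0 _ p0 Cp0) (bd _ q w0 wn).
  have e1 : E ^+ p * n%:R ^+ p * (Cq * n%:R ^+ q0) = E ^+ p * Cq * n%:R ^+ (p0 + q0).+1.
    by rewrite /p -addSn exprD; ring.
  have e2 : E ^+ q * n%:R ^+ q * (Cp * n%:R ^+ p0) = E ^+ q * Cp * n%:R ^+ (p0 + q0).+1.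
    by rewrite /q -addnS exprD; ring.
  rewrite natrM; lra.
have l1 := term _ _ _ _ x0 y0 xE yE (hp _ _ _ n0 x0 xn xx) (hq _ _ _ n0 y0 yn yy).
have l2 := term _ _ _ _ y0 x0 yE xE (hp _ _ _ n0 y0 yn yy) (hq _ _ _ n0 x0 xn xx).
have : (Phi x' y')%:R <= (fmax n)%:R :> rat.
  rewrite ler_nat; apply: leq_trans (Phi_le_fmax _ _) _.
  by rewrite subnKC // geq_minr.
rewrite /Phi natrD -/p -/q [(x' ^_ q * _)%N]mulnC /Q [x ^+ q * _]mulrC; lra.
Qed.

(** Evaluate [Q] at the balanced point, where it is [2 * c * n ^ (p + q)]; for large [n] half of
    this absorbs the error of [Q_le_fmax]. *)
Lemma fmax_ge : exists2 c : rat, 0 < c &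
  exists n0, forall n, (n0 <= n)%N -> c * n%:R ^+ (p0 + q0).+2 <= (fmax n)%:R.
Proof.
have [C C0 hC] := Q_le_fmax 0.
pose c : rat := 2^-1 ^+ (p0 + q0).+2.
have c0 : 0 < c by rewrite exprn_gt0.
exists c => //.
exists (Num.truncn (C / c)).+1 => n hn.
have n0 : (0 < n)%N by apply: leq_trans hn.
have nC : C / c < n%:R.
  have /andP[_ h] := truncn_itv (divr_ge0 C0 (ltW c0)).
  by apply: lt_le_trans h _; rewrite ler_nat.
have n1 : 0 < n%:R :> rat by rewrite ltr0n.
have := hC n (n%:R / 2) (n%:R / 2) n0 ltac:(lra) ltac:(lra) ltac:(lra).
have -> : Q (n%:R / 2) (n%:R / 2) = 2 * c * n%:R * n%:R ^+ (p0 + q0).+1.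
  rewrite /Q -!exprD [(q + p)%N]addnC /p /q addSn addnS exprMn /c exprS; ring.
rewrite ltr_pdivrMr // in nC.
have : C * n%:R ^+ (p0 + q0).+1 <= n%:R * c * n%:R ^+ (p0 + q0).+1.
  by apply: ler_wpM2r; [rewrite exprn_ge0 // ltW | apply: ltW].
rewrite [n%:R ^+ (p0 + q0).+2]exprS; lra.
Qed.

(** Second-order estimate for shifting [k] from one part to the other: multiply the Bernoulli bounds
    of the two powers; only one quadratic term arises. *)
Lemma Q_taylor (x y k : rat) : 0 <= k -> k <= x -> 0 <= y ->
  Q x y + k * ((q%:R * x ^+ p * y ^+ q0 + p%:R * x ^+ q * y ^+ p0)
             - (p%:R * x ^+ p0 * y ^+ q + q%:R * x ^+ q0 * y ^+ p))
   - 2 * p%:R * q%:R * k ^+ 2 * (x + y) ^+ (p0 + q0) <= Q (x - k) (y + k).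
Proof.
move=> k0 kx y0; have x0 : 0 <= x by lra.
have xk : 0 <= x + - k by lra.
have yk : 0 <= y + k by lra.
have term a b : x ^+ a.+1 * y ^+ b.+1
    + k * (b.+1%:R * x ^+ a.+1 * y ^+ b - a.+1%:R * x ^+ a * y ^+ b.+1)
    - a.+1%:R * b.+1%:R * k ^+ 2 * (x + y) ^+ (a + b)
    <= (x - k) ^+ a.+1 * (y + k) ^+ b.+1.
  have h1 := bernoulli a x0 xk; have h2 := bernoulli b y0 yk.
  have xa := exprn_ge0 a x0; have yb := exprn_ge0 b y0.
  have D0 : 0 <= y ^+ b.+1 + b.+1%:R * k * y ^+ b.
    by rewrite addr_ge0 ?exprn_ge0 // !mulr_ge0 ?ler0n //.
  (* The Bernoulli bound for [x - k] may be negative, so [h2] is multiplied by the true power of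
     [x - k] and [h1] by the nonnegative bound [D0]. *)
  have k1 := ler_wpM2l (exprn_ge0 a.+1 xk) h2.
  have k2 := ler_wpM2r D0 h1.
  apply: le_trans (le_trans k2 k1).
  have e : x ^+ a * y ^+ b <= (x + y) ^+ (a + b).
    by rewrite exprD ler_pM // lerXn2r ?nnegrE //; lra.
  have P0 : 0 <= a.+1%:R * b.+1%:R * k ^+ 2 :> rat.
    by rewrite !mulr_ge0 ?exprn_ge0 ?ler0n //.
  have := ler_wpM2l P0 e.
  set M := a.+1%:R; set N := b.+1%:R; rewrite ![_ ^+ a.+1]exprS ![_ ^+ b.+1]exprS !expr2.
  nra.
have := term p0 q0; have := term q0 p0.
rewrite /Q -/p -/q [(q0 + p0)%N]addnC => h1 h2; lra.
Qed.

End Analysis.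

Local Open Scope nat_scope.

(** * Counting homomorphisms *)

(** Stated for relations, so that an induced subgraph is just a relation pulled back to a
    subtype. *)
Definition homs (U V : finType) (h : rel U) (e : rel V) : {set {ffun U -> V}} :=
  [set f : {ffun U -> V} | [forall u, forall w, h u w ==> e (f u) (f w)]].

Definition injs (U V : finType) (h : rel U) (e : rel V) : {set {ffun U -> V}} :=
  [set f in homs h e | injectiveb f].

Definition deg (V : finType) (e : rel V) v := #|[set w | e v w]|.

Lemma homsP (U V : finType) (h : rel U) (e : rel V) (f : {ffun U -> V}) :
  reflect (forall u w, h u w -> e (f u) (f w)) (f \in homs h e).
Proof.
rewrite inE; apply: (iffP forallP) => H u; last first.
  by apply/forallP => w; apply/implyP/H.
by move=> w; apply/implyP; exact: (forallP (H u)).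
Qed.

Lemma injsP (U V : finType) (h : rel U) (e : rel V) (f : {ffun U -> V}) :
  reflect ((forall u w, h u w -> e (f u) (f w)) /\ injective f) (f \in injs h e).
Proof.
rewrite inE; apply: (iffP andP) => -[/homsP H /injectiveP I]; split=> //; exact/homsP.
Qed.

Section Counting.
Variables U V : finType.
Implicit Types (S : {set {ffun U -> V}}) (F : U -> {set V}).

Lemma leq_card_family S F :
  (forall f, f \in S -> forall u, f u \in F u) -> #|S| <= \prod_u #|F u|.
Proof.
move=> H; have -> : \prod_u #|F u| = #|family (fun u => mem (F u))|.
  by rewrite card_family foldrE big_map big_enum.
by apply/subset_leq_card/subsetP => f /H fF; apply/familyP => u; exact: fF.
Qed.

(** Fix the images of [u0] and [u1] first: this exploits an edge of H whose image is confined to a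
    small set of pairs. *)
Lemma leq_card_family_pair S F u0 u1 (D : {set V * V}) : u0 != u1 ->
  (forall f, f \in S -> (f u0, f u1) \in D) ->
  (forall f, f \in S -> forall u, u != u0 -> u != u1 -> f u \in F u) ->
  #|S| <= #|D| * \prod_(u | (u != u0) && (u != u1)) #|F u|.
Proof.
move=> u01 SD SF.
rewrite -sum1_card (partition_big (fun f : {ffun U -> V} => (f u0, f u1)) (mem D)) //=.
rewrite -sum_nat_const; apply: leq_sum => -[x y] _.
rewrite sum1dep_card.
pose F' u := if u == u0 then [set x] else if u == u1 then [set y] else F u.
apply: leq_trans (leq_card_family (F := F') _) _.
  move=> f; rewrite inE => /andP[fS /eqP[fx fy]] u; rewrite /F'.
  have [->|un0] := eqVneq u u0; first by rewrite inE fx.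
  have [->|un1] := eqVneq u u1; first by rewrite inE fy.
  exact: SF.
rewrite (bigD1 u0) //= (bigD1 u1) //=; last by rewrite eq_sym.
rewrite /F' eqxx [u1 == u0]eq_sym (negPf u01) eqxx !cards1 !mul1n.
by apply: leq_prod => u /andP[/negPf-> /negPf->].
Qed.

Lemma leq_card_pair S u0 u1 (D : {set V * V}) : u0 != u1 ->
  (forall f, f \in S -> (f u0, f u1) \in D) -> #|S| <= #|D| * #|V| ^ (#|U| - 2).
Proof.
move=> u01 SD.
apply: leq_trans (leq_card_family_pair (F := fun=> setT) u01 SD _) _.
  by move=> *; rewrite inE.
rewrite cardsT prod_nat_const leq_mul2l; apply/orP; right.
have -> // : #|[pred u | (u != u0) && (u != u1)]| = #|U| - 2.
have := cardC [pred u | (u != u0) && (u != u1)].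
have -> : #|[predC [pred u | (u != u0) && (u != u1)]]| = #|[set u0; u1]|.
  by apply: eq_card => u; rewrite !inE negb_and !negbK.
by move=> <-; rewrite cards2 u01 addnK.
Qed.

End Counting.

(** AM-GM with equal factors collected: the weight of [a] is the proportion of [j] with [pi j = a].
    The weights do not depend on [z], so one choice serves all homomorphisms at once. *)
Lemma agm (I : finType) (J A : {set I}) (pi : I -> I) a0 : a0 \in A ->
  (forall j, j \in J -> pi j \in A) ->
  exists l : I -> rat, [/\ forall a, (0 <= l a)%R, (\sum_(a in A) l a = 1)%R &
   forall z : I -> rat, (forall a, 0 <= z a)%R ->
    (\prod_(j in J) z (pi j) <= \sum_(a in A) l a * z a ^+ #|J|)%R].
Proof.
move=> a0A piA; have [->|J0] := eqVneq J set0.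
  (* For empty [J] the product is 1, and any weights of sum 1 will do. *)
  exists (fun a => (a == a0)%:R%R); split.
  - by move=> a; exact: ler0n.
  - rewrite (bigD1 a0) //= eqxx big1 ?addr0 // => a /andP[_ /negPf->] //.
  - move=> z _; rewrite big_set0 cards0 (bigD1 a0) //= eqxx expr0 big1 ?addr0 ?mulr1 //.
    by move=> a /andP[_ /negPf->]; rewrite mul0r.
have c0 : 0 < #|J| by rewrite card_gt0.
set c := #|J| in c0 *.
have c0R : (0 < c%:R :> rat)%R by rewrite ltr0n.
exists (fun a => (#|[set j in J | pi j == a]|%:R / c%:R)%R).
have eqS (z : I -> rat) : (\sum_(a in A) #|[set j in J | pi j == a]|%:R / c%:R * z a
    = (\sum_(j in J) z (pi j)) / c%:R)%R.
  rewrite [X in _ = (X / _)%R](partition_big pi (mem A)) //= mulr_suml; apply: eq_bigr => a _.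
  rewrite mulrAC; congr (_ * _)%R.
  rewrite (eq_bigr (fun=> z a)) => [|j /andP[_ /eqP->] //].
  by rewrite sumr_const mulr_natl; congr (_ *+ _)%R; apply: eq_card => j; rewrite !inE.
split.
- by move=> a; rewrite divr_ge0 ?ler0n.
- have := eqS (fun=> 1%R); rewrite sumr_const divff ?lt0r_neq0 // => H.
  by apply: etrans H; apply: eq_bigr => a _; rewrite mulr1.
move=> z z0; rewrite eqS -(@ler_pXn2r _ c) //; last 2 first.
- by rewrite nnegrE prodr_ge0.
- by rewrite nnegrE divr_ge0 ?ler0n // sumr_ge0 // => j _; rewrite exprn_ge0.
have [H _] := @leif_AGM _ _ (mem J) (fun j => z (pi j) ^+ c)%R (fun j _ => exprn_ge0 c (z0 _)).
by rewrite -prodrXl.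
Qed.

(** * Homomorphisms of H against a degree sum over edges *)

Section HomBound.
Variables (U : finType) (h : rel U) (side : pred U) (A B : {set U}) (pi : U -> U).
Variables (a0 b0 : U) (p0 q0 : nat).
Hypothesis h_side : forall u w, h u w -> side u != side w.
Hypothesis A_side : forall a, a \in A -> side a.
Hypothesis B_side : forall b, b \in B -> ~~ side b.
Hypothesis AB : forall a b, a \in A -> b \in B -> h a b.
Hypothesis h_pi : forall u, h (pi u) u.
Hypothesis pi_AB : forall u, pi u \in A :|: B.
Hypothesis a0A : a0 \in A.
Hypothesis b0B : b0 \in B.
Hypothesis cardP : #|[set u | side u]| = p0.+1.
Hypothesis cardQ : #|[set u | ~~ side u]| = q0.+1.

Lemma pi_A u : ~~ side u -> pi u \in A.
Proof.
move=> su; have := pi_AB u; rewrite inE => /orP[//|/B_side pB].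
by have := h_side (h_pi u); rewrite (negPf pB) (negPf su).
Qed.

Lemma pi_B u : side u -> pi u \in B.
Proof.
move=> su; have := pi_AB u; rewrite inE => /orP[/A_side pA|//].
by have := h_side (h_pi u); rewrite su pA.
Qed.

Let JP := [set u | (u \notin A) && side u].
Let JQ := [set u | (u \notin B) && ~~ side u].

Lemma card_JP : #|JP| + #|A :\ a0| = p0.
Proof.
apply: succn_inj; rewrite -cardP -addnS -[_.+1]add1n.
have -> : 1 + #|A :\ a0| = #|A| by rewrite (cardsD1 a0 A) a0A.
rewrite -(cardsID A [set u | side u]) addnC; congr (_ + _).
  by apply: eq_card => u; rewrite !inE; case: (boolP (u \in A)) => [/A_side->|]; rewrite ?andbF ?andbT.
by apply: eq_card => u; rewrite !inE.
Qed.

Lemma card_JQ : #|JQ| + #|B :\ b0| = q0.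
Proof.
apply: succn_inj; rewrite -cardQ -addnS -[_.+1]add1n.
have -> : 1 + #|B :\ b0| = #|B| by rewrite (cardsD1 b0 B) b0B.
rewrite -(cardsID B [set u | ~~ side u]) addnC; congr (_ + _).
  by apply: eq_card => u; rewrite !inE; case: (boolP (u \in B)) => [/B_side->|]; rewrite ?andbF ?andbT.
by apply: eq_card => u; rewrite !inE.
Qed.

Section G.
Variables (V : finType) (e : rel V).
Hypothesis e_sym : symmetric e.

(** Homomorphisms of K alone, encoded as total maps with the dummy value [x0] off K. *)
Let Phis x0 := [set f : {ffun U -> V} |
  [forall a in A, forall b in B, e (f a) (f b)] &&
  [forall u, (u \notin A :|: B) ==> (f u == x0)]].

Lemma disjAB u : u \in A -> u \in B -> False.
Proof. by move=> /A_side su /B_side; rewrite su. Qed.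

(** Group by the restriction to K: a vertex [u] outside K must go to a neighbour of the image of
    [pi u]. *)
Lemma homs_ext x0 : #|homs h e| <=
  \sum_(f in Phis x0) (\prod_(u in JP) deg e (f (pi u)) * \prod_(u in JQ) deg e (f (pi u))).
Proof.
pose res (f : {ffun U -> V}) := [ffun u => if u \in A :|: B then f u else x0].
rewrite -sum1_card (partition_big res (mem (Phis x0))) /=; last first.
  move=> f /homsP fh; rewrite inE; apply/andP; split.
    apply/forall_inP => a aA; apply/forall_inP => b bB.
    by rewrite !ffunE !inE aA bB orbT fh // AB.
  by apply/forallP => u; apply/implyP => /negPf uAB; rewrite ffunE uAB.
apply: leq_sum => g _; rewrite sum1dep_card.
pose F u := if u \in A :|: B then [set g u] else [set w | e (g (pi u)) w].
apply: leq_trans (leq_card_family (F := F) _) _.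
  rewrite /F => f; rewrite inE => /andP[/homsP fh /eqP <-] u.
  case: ifP => uAB; first by rewrite ffunE uAB inE.
  by rewrite inE ffunE pi_AB fh.
rewrite [\prod_(u in JP) _]big_mkcond [\prod_(u in JQ) _]big_mkcond -big_split /=.
apply: leq_prod => u _; rewrite /F !inE.
case: (boolP (u \in A)) => [uA|uA] /=.
  by rewrite cards1 (A_side uA) andbF.
case: (boolP (u \in B)) => [uB|uB] /=.
  by rewrite cards1 (negPf (B_side uB)).
by case: (side u); rewrite ?muln1 ?mul1n.
Qed.

(** The number of homomorphisms of the double star with [q0] leaves at one centre and [p0] at the
    other, whose parts have the same sizes as those of H. *)
Definition weight := \sum_x \sum_(y | e x y) deg e x ^ q0 * deg e y ^ p0.

(** Once [a] and [b] go to [x] and [y], the rest of [A] maps into the neighbours of [y] and the rest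
    of [B] into those of [x]; these factors complete the exponents to [q0] and [p0]. *)
Lemma Phis_sum x0 a b : a \in A -> b \in B ->
  \sum_(f in Phis x0) deg e (f a) ^ #|JQ| * deg e (f b) ^ #|JP| <= weight.
Proof.
move=> aA bB.
have cA : #|JP| + #|A :\ a| = p0.
  by rewrite -card_JP; have := cardsD1 a A; have := cardsD1 a0 A; rewrite aA a0A; lia.
have cB : #|JQ| + #|B :\ b| = q0.
  by rewrite -card_JQ; have := cardsD1 b B; have := cardsD1 b0 B; rewrite bB b0B; lia.
rewrite /weight pair_big_dep /=.
rewrite (partition_big (fun f : {ffun U -> V} => (f a, f b)) (fun xy => e xy.1 xy.2)) /=; last first.
  by move=> f; rewrite inE => /andP[/forall_inP/(_ a aA)/forall_inP/(_ b bB)].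
apply: leq_sum => -[x y] /= exy.
rewrite (eq_bigr (fun=> deg e x ^ #|JQ| * deg e y ^ #|JP|)) => [|f /andP[_ /eqP[-> ->]] //].
rewrite sum_nat_const mulnC -cA -cB !expnD -mulnA [X in _ <= X](_ : _ =
  deg e x ^ #|JQ| * (deg e y ^ #|JP| * (deg e x ^ #|B :\ b| * deg e y ^ #|A :\ a|))); last by lia.
rewrite leq_mul2l leq_mul2l; apply/orP; right; apply/orP; right.
pose F u := if u == a then [set x] else if u == b then [set y] else
  if u \in A then [set w | e y w] else if u \in B then [set w | e x w] else [set x0].
pose S := [set f in Phis x0 | (f a, f b) == (x, y)].
have -> : #|[pred f | (f \in Phis x0) && ((f a, f b) == (x, y))]| = #|S|.
  by apply: eq_card => f; rewrite !inE.
apply: leq_trans (leq_card_family (S := S) (F := F) _) _.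
  move=> f; rewrite !inE -andbA => /and3P[/forall_inP fe /forallP f0 /eqP[fx fy]] u; rewrite /F.
  have [->|ua] := eqVneq u a; first by rewrite inE fx.
  have [->|ub] := eqVneq u b; first by rewrite inE fy.
  case: (boolP (u \in A)) => uA.
    by rewrite inE -fy e_sym; exact: (forall_inP (fe u uA)).
  case: (boolP (u \in B)) => uB.
    by rewrite inE -fx; exact: (forall_inP (fe a aA)).
  by rewrite inE; have := f0 u; rewrite !inE negb_or uA uB.
rewrite -!prod_nat_const [\prod_(u in B :\ b) _]big_mkcond [\prod_(u in A :\ a) _]big_mkcond -big_split /=.
apply: leq_prod => u _; rewrite /F !inE.
have [->|ua] := eqVneq u a.
  rewrite cards1 /=; case: (boolP (a \in B)) => [aB|_]; last by rewrite andbF.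
  by case: (disjAB aA aB).
have [->|ub] := eqVneq u b.
  rewrite cards1 /=; case: (boolP (b \in A)) => [bA|_] //.
  by case: (disjAB bA bB).
case: (boolP (u \in A)) => [uA|_] /=.
  by case: (boolP (u \in B)) => [uB|_] //=; [case: (disjAB uA uB) | rewrite mul1n].
by case: (boolP (u \in B)) => _ /=; rewrite ?muln1 // cards1.
Qed.

(* Conditioning on the image of K, each remaining vertex of H contributes the degree of the
   image of a vertex of K; AM-GM lets these be the same two vertices for every factor. *)
Lemma homs_weight : #|homs h e| <= weight.
Proof.
(* A homomorphism provides the dummy vertex; [V] might otherwise be empty. *)
have [->|[f0 _]] := set_0Vmem (homs h e); first by rewrite cards0.
pose x0 := f0 a0.
have [la [la0 la1 laP]] := @agm U JQ A pi a0 a0A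
  ltac:(by move=> j; rewrite inE => /andP[_ /pi_A]).
have [lb [lb0 lb1 lbP]] := @agm U JP B pi b0 b0B
  ltac:(by move=> j; rewrite inE => /andP[_ /pi_B]).
rewrite -(ler_nat rat); apply: le_trans (_ : (\sum_(f in Phis x0)
  (\prod_(u in JP) deg e (f (pi u)) * \prod_(u in JQ) deg e (f (pi u))))%:R <= _)%R.
  by rewrite ler_nat homs_ext.
rewrite natr_sum.
apply: le_trans (_ : \sum_(f in Phis x0) \sum_(a in A) \sum_(b in B)
   la a * lb b * (deg e (f a) ^ #|JQ| * deg e (f b) ^ #|JP|)%:R <= _)%R.
  apply: ler_sum => f _; rewrite natrM !natr_prod.
  have ha := laP (fun u => (deg e (f u))%:R)%R (fun u => ler0n _ _).
  have hb := lbP (fun u => (deg e (f u))%:R)%R (fun u => ler0n _ _).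
  rewrite mulrC; apply: le_trans (ler_pM _ _ ha hb) _; try by apply: prodr_ge0.
  rewrite mulr_suml; apply: ler_sum => a _; rewrite mulr_sumr; apply: ler_sum => b _.
  by rewrite natrM !natrX mulrACA.
rewrite exchange_big /=.
apply: le_trans (_ : \sum_(a in A) la a * (\sum_(b in B) lb b * weight%:R) <= _)%R; last first.
  by rewrite -!mulr_suml la1 lb1 !mul1r.
apply: ler_sum => a aA; rewrite exchange_big /= mulr_sumr; apply: ler_sum => b bB.
rewrite -mulr_sumr mulrA ler_wpM2l ?mulr_ge0 // -natr_sum ler_nat.
exact: Phis_sum.
Qed.
End G.
End HomBound.

Local Open Scope nat_scope.

(** * Edges of F-free graphs have few common neighbours *)

Lemma ffact_mono k : {homo (fun x => x ^_ k) : x y / x <= y}.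
Proof.
elim: k => [|k IH] [|x] [|y] //= xy; rewrite ?ffactn0 // ffactSS ffactSS.
by rewrite leq_mul // IH.
Qed.

Section Codegree.
(* c is a proper 2-colouring of F minus its critical edge w1w2. *)
Variables (W : finType) (hF : rel W) (c : pred W) (w1 w2 : W).
Hypothesis hF_c : forall u w, hF u w ->
  [|| c u != c w, (u == w1) && (w == w2) | (u == w2) && (w == w1)].
Hypothesis w12 : w1 != w2.
Variables (V : finType) (e : rel V).
Hypothesis e_sym : symmetric e.
Hypothesis e_irr : irreflexive e.
Hypothesis F_free : injs hF e = set0.

(* F minus a critical edge is bipartite, so F embeds as soon as the edge xy together
   with the image of an injection g : W -> V has at least |W| common neighbours. *)
Lemma common_nbrs_lt x y (g : {ffun W -> V}) : c w1 -> c w2 -> e x y -> injective g ->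
  (forall w, g w != x) -> (forall w, g w != y) ->
  #|[set z | [&& e x z, e y z & [forall w, e z (g w)]]]| < #|W|.
Proof.
move=> c1 c2 exy ginj gx gy; rewrite ltnNge; apply/negP; set Z := [set z | _] => WZ.
pose z (w : W) := nth x (enum Z) (enum_rank w).
have zsz (w : W) : enum_rank w < size (enum Z).
  by rewrite -cardE; apply: leq_trans (ltn_ord _) WZ.
have zZ w : [&& e x (z w), e y (z w) & [forall w', e (z w) (g w')]].
  have : z w \in enum Z by rewrite mem_nth.
  by rewrite mem_enum inE.
have zinj : injective z.
  move=> u w /eqP; rewrite nth_uniq ?enum_uniq // => /eqP /ord_inj.
  exact: enum_rank_inj.
have ne a b : e a b -> a <> b by move=> ab E; rewrite E e_irr in ab.
(* The colour class containing [w1] and [w2] is placed by [a], the other class by [z]. Every [a u]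
   is adjacent to every [z w], so the two images are disjoint. *)
pose a w := if w == w1 then x else if w == w2 then y else g w.
have eaz u w : e (a u) (z w).
  case/and3P: (zZ w) => ex ey /forallP eg; rewrite /a.
  by case: ifP => // _; case: ifP => // _; rewrite e_sym.
have aw1 : a w1 = x by rewrite /a eqxx.
have aw2 : a w2 = y by rewrite /a eqxx eq_sym (negPf w12).
have ainj : injective a.
  have xy := ne _ _ exy; have gx' w := elimN eqP (gx w); have gy' w := elimN eqP (gy w).
  move=> u w; rewrite /a.
  have [->|_] := eqVneq u w1; have [->|_] := eqVneq w w1 => //.
  - by case: ifP => _ E; [case: xy | case: (gx' w)].
  - by case: ifP => _ E; [case: xy | case: (gx' u)].
  have [->|_] := eqVneq u w2; have [->|_] := eqVneq w w2 => //.
  - by move=> E; case: (gy' w).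
  - by move=> E; case: (gy' u).
  exact: ginj.
pose f := [ffun w => if c w then a w else z w].
suff : f \in injs hF e by rewrite F_free inE.
apply/injsP; split.
  move=> u w /hF_c /or3P[|/andP[/eqP-> /eqP->]|/andP[/eqP-> /eqP->]]; rewrite !ffunE.
  - by case: (c u) (c w) => [] [] //= _; rewrite e_sym.
  - by rewrite c1 c2 aw1 aw2.
  - by rewrite c1 c2 aw1 aw2 e_sym.
move=> u w; rewrite !ffunE; case: (c u) (c w) => [] [].
- exact: ainj.
- by move/ne: (eaz u w).
- by move/esym; move/ne: (eaz w u).
- exact: zinj.
Qed.

(** Double count pairs of a common neighbour [z] and an injection of [W] into the neighbours of [z]
    other than [x] and [y]. Each [z] has many such injections, and by [common_nbrs_lt] each
    injection serves fewer than [#|W|] of the [z]. *)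
Lemma codegree_bound d x y : c w1 -> c w2 -> (forall v, d <= deg e v) -> e x y ->
  #|[set z | e x z && e y z]| * (d - 2) ^_ #|W| <= #|W| * #|V| ^ #|W|.
Proof.
move=> c1 c2 dd exy; set C := [set z | _].
pose G := [set g : {ffun W -> V} | injectiveb g && [forall w, (g w != x) && (g w != y)]].
have GV : #|G| <= #|V| ^ #|W| by rewrite -card_ffun max_card.
have nbr z : (d - 2) ^_ #|W| <= #|[set g in G | [forall w, e z (g w)]]|.
  pose R := [set v | e z v] :\: [set x; y].
  have dR : d - 2 <= #|R|.
    rewrite cardsD; apply: leq_sub (dd z) _.
    by apply: leq_trans (subset_leq_card (subsetIr _ _)) _; rewrite cards2; case: (x == y).
  apply: leq_trans (ffact_mono _ dR) _; rewrite -(card_inj_ffuns_on W (mem R)).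
  apply/subset_leq_card/subsetP => g; rewrite !inE => /andP[/ffun_onP gR ->] /=.
  apply/andP; split; apply/forallP => w; move: (gR w); rewrite !inE negb_or; first by case/andP.
  by case/andP.
have : \sum_(z in C) (d - 2) ^_ #|W| <= \sum_(z in C) \sum_(g in G) [forall w, e z (g w)].
  apply: leq_sum => z _; apply: leq_trans (nbr z) _.
  rewrite -sum1_card big_mkcond [X in _ <= X]big_mkcond; apply: leq_sum => g _.
  by rewrite !inE; case: (injectiveb g) => //=; case: [forall _, _] => //=; case: [forall _, _].
rewrite sum_nat_const exchange_big /= => H; apply: leq_trans H _.
apply: leq_trans (_ : \sum_(g in G) #|W| <= _); last first.
  by rewrite sum_nat_const mulnC leq_mul2l GV orbT.
apply: leq_sum => g; rewrite inE => /andP[/injectiveP gi /forallP gxy].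
have gx w : g w != x by case/andP: (gxy w).
have gy w : g w != y by case/andP: (gxy w).
apply: leq_trans (ltnW (common_nbrs_lt c1 c2 exy gi gx gy)).
rewrite -sum1_card big_mkcond [X in _ <= X]big_mkcond; apply: leq_sum => z _.
by rewrite !inE andbA; case: (_ && _) => //=; case: [forall _, _].
Qed.

End Codegree.

(** * Injections respecting a bipartition *)

Section InjSides.
Variables (U V : finType) (side : pred U) (X : {set V}).

Let S := [set f : {ffun U -> V} | injectiveb f & [forall u, (f u \in X) == side u]].

Lemma card_inj_sides_le :
  #|S| <= #|X| ^_ #|[set u | side u]| * #|~: X| ^_ #|[set u | ~~ side u]|.
Proof.
pose T1 := {u | side u}; pose T2 := {u | ~~ side u}.
have c1 : #|[set u | side u]| = #|{: T1}| by rewrite card_sig; apply: eq_card => u; rewrite !inE.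
have c2 : #|[set u | ~~ side u]| = #|{: T2}| by rewrite card_sig; apply: eq_card => u; rewrite !inE.
rewrite c1 c2 -(card_inj_ffuns_on T1 (mem X)) -(card_inj_ffuns_on T2 (mem (~: X))) -cardsX.
pose r (f : {ffun U -> V}) := ([ffun u : T1 => f (val u)], [ffun u : T2 => f (val u)]).
rewrite -(card_imset (f := r) (mem S)); last first.
  move=> f g [/ffunP E1 /ffunP E2]; apply/ffunP => u.
  case: (boolP (side u)) => su.
    by have := E1 (exist _ u su); rewrite !ffunE.
  by have := E2 (exist _ u su); rewrite !ffunE.
apply/subset_leq_card/subsetP => _ /imsetP[f + ->].
rewrite !inE /= => /andP[/injectiveP fi /forallP fs].
apply/andP; split; apply/andP; split.
- by apply/ffun_onP => -[u su]; rewrite ffunE /= (eqP (fs u)).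
- by apply/injectiveP => u w; rewrite !ffunE => /fi/val_inj.
- by apply/ffun_onP => -[u su]; rewrite ffunE /= inE (eqP (fs u)).
- by apply/injectiveP => u w; rewrite !ffunE => /fi/val_inj.
Qed.

(** Injections of the two classes into [X] and its complement glue to an injection, since the
    targets are disjoint; [s] tells which of the two maps applies. *)
Lemma card_inj_sides_ge :
  #|X| ^_ #|[set u | side u]| * #|~: X| ^_ #|[set u | ~~ side u]| <= #|S|.
Proof.
pose T1 := {u | side u}; pose T2 := {u | ~~ side u}.
have c1 : #|[set u | side u]| = #|{: T1}| by rewrite card_sig; apply: eq_card => u; rewrite !inE.
have c2 : #|[set u | ~~ side u]| = #|{: T2}| by rewrite card_sig; apply: eq_card => u; rewrite !inE.
rewrite c1 c2 -(card_inj_ffuns_on T1 (mem X)) -(card_inj_ffuns_on T2 (mem (~: X))) -cardsX.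
pose s u : T1 + T2 := match boolP (side u) with
  | AltTrue h => inl (exist _ u h) | AltFalse h => inr (exist _ u h) end.
have s1 u : if s u is inl v then val v = u else side u = false.
  by rewrite /s; case: {-}_ / boolP => //= /negPf.
have s2 u : if s u is inr v then val v = u else side u.
  by rewrite /s; case: {-}_ / boolP.
pose m (g : {ffun T1 -> V} * {ffun T2 -> V}) : {ffun U -> V} :=
  [ffun u => match s u with inl v => g.1 v | inr v => g.2 v end].
have sl (v : T1) : s (val v) = inl v.
  have := s1 (val v); case: (s (val v)) => [w /val_inj-> //|w]; by rewrite (valP v).
have sr (v : T2) : s (val v) = inr v.
  have := s2 (val v); case: (s (val v)) => [w|w /val_inj-> //]; by rewrite (negPf (valP v)).
have minj : injective m.
  move=> [g1 g2] [g1' g2'] /ffunP E; congr (_, _); apply/ffunP => v.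
    by have := E (val v); rewrite !ffunE sl.
  by have := E (val v); rewrite !ffunE sr.
rewrite -(card_imset _ minj).
apply/subset_leq_card/subsetP => _ /imsetP[[g1 g2] + ->].
rewrite !inE /= => /andP[/andP[/ffun_onP o1 /injectiveP i1] /andP[/ffun_onP o2 /injectiveP i2]].
have o2' v : g2 v \notin X by have := o2 v; rewrite inE.
apply/andP; split; last first.
  apply/forallP => u; rewrite ffunE; have := s1 u; have := s2 u.
  case: (s u) => v; first by move=> -> _; rewrite o1.
  by move=> _ ->; rewrite (negPf (o2' v)).
apply/injectiveP => u w; rewrite !ffunE; have := s1 u; have := s2 u; have := s1 w; have := s2 w.
case: (s u) (s w) => [v|v] [v'|v'].
- by move=> _ <- _ <- /i1->.
- by move=> _ _ _ _ E; have := o2' v'; rewrite -E o1.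
- by move=> _ _ _ _ E; have := o2' v; rewrite E o1.
- by move=> <- _ <- _ /i2->.
Qed.
End InjSides.

(** * Averaging over edges and numerical estimates *)

Local Open Scope ring_scope.

Lemma eventually_ge (K : rat) : exists n0, forall n, (n0 <= n)%N -> K <= n%:R.
Proof.
exists (Num.truncn `|K|).+1 => n hn.
have /andP[_ h] := truncn_itv (normr_ge0 K).
apply: le_trans (ler_norm K) _; apply: le_trans (ltW h) _.
by rewrite ler_nat.
Qed.

Lemma leq_card_bigcup (I T : finType) (P : pred I) (F : I -> {set T}) :
  (#|\bigcup_(i | P i) F i| <= \sum_(i | P i) #|F i|)%N.
Proof.
elim/big_rec2: _ => [|i n S _ H]; first by rewrite cards0.
by apply: leq_trans (leq_card_setU _ _) _; rewrite leq_add2l.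
Qed.

(* Otherwise multiply by 1/(d(a) d(b)) and sum over the edges: the Q-side gives
   n * weight >= n K, while K times the sum of 1/d(a) + 1/d(b) is at most K n. *)
Lemma heavy_edge (p0 q0 : nat) (V : finType) (e : rel V) (K : rat) :
  symmetric e -> 0 < K -> K <= (weight p0 q0 e)%:R -> (exists x y, e x y) ->
  exists a b, e a b /\ K * ((deg e a)%:R + (deg e b)%:R) <=
     #|V|%:R * Q p0 q0 (deg e a)%:R (deg e b)%:R.
Proof.
move=> e_sym K0 Kw [x0 [y0 exy]].
pose d v : rat := (deg e v)%:R.
suff /existsP[a /existsP[b /andP[eab H]]] : [exists a, exists b, e a b &&
    (K * (d a + d b) <= #|V|%:R * Q p0 q0 (d a) (d b))] by exists a, b.
apply: contraT => /existsPn NE.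
have {}NE a b : e a b -> #|V|%:R * Q p0 q0 (d a) (d b) < K * (d a + d b).
  by move=> eab; have := existsPn (NE a) b; rewrite eab /= ltNge.
have d0 a b : e a b -> 0 < d a.
  by move=> eab; rewrite ltr0n; apply/card_gt0P; exists b; rewrite inE.
pose g a b : rat := d a ^+ q0 * d b ^+ p0 + d b ^+ q0 * d a ^+ p0.
pose r a b : rat := (d a)^-1 + (d b)^-1.
have lt_gr a b : e a b -> #|V|%:R * g a b < K * r a b.
  move=> eab; have da := d0 _ _ eab; have db : 0 < d b by apply: (d0 b a); rewrite e_sym.
  have ab0 : 0 < d a * d b by apply: mulr_gt0.
  rewrite -(ltr_pM2r ab0).
  have -> : #|V|%:R * g a b * (d a * d b) = #|V|%:R * Q p0 q0 (d a) (d b).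
    by rewrite /g /Q !exprS; ring.
  have -> : K * r a b * (d a * d b) = K * (d a + d b).
    by rewrite /r; field; rewrite !lt0r_neq0.
  exact: NE.
have sw (f : V -> V -> rat) : \sum_a \sum_(b | e a b) f b a = \sum_a \sum_(b | e a b) f a b.
  rewrite (exchange_big_dep predT) //=; apply: eq_bigr => b _.
  by apply: eq_bigl => a; rewrite e_sym.
have Sg : \sum_a \sum_(b | e a b) g a b = 2 * (weight p0 q0 e)%:R.
  have -> : (weight p0 q0 e)%:R = \sum_a \sum_(b | e a b) d a ^+ q0 * d b ^+ p0.
    rewrite /weight natr_sum; apply: eq_bigr => a _; rewrite natr_sum.
    by apply: eq_bigr => b _; rewrite natrM !natrX.
  under eq_bigr do rewrite big_split.
  by rewrite big_split /= (sw (fun a b => d a ^+ q0 * d b ^+ p0)); ring.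
have Sr : \sum_a \sum_(b | e a b) r a b <= 2 * #|V|%:R.
  under eq_bigr do rewrite big_split.
  rewrite big_split /= (sw (fun a b => (d a)^-1)).
  suff : \sum_a \sum_(b | e a b) (d a)^-1 <= #|V|%:R by lra.
  rewrite -sum1_card natr_sum; apply: ler_sum => a _; rewrite sumr_const.
  have -> : #|e a| = deg e a by apply: eq_card => b; rewrite inE.
  rewrite -[X in X <= _]mulr_natl /d; have [->|dn] := eqVneq ((deg e a)%:R : rat) 0; first by rewrite mul0r.
  by rewrite divff.
have : \sum_a \sum_(b | e a b) (#|V|%:R * g a b) < \sum_a \sum_(b | e a b) (K * r a b).
  (* One existing edge is split off to make the summed inequality strict. *)
  rewrite !pair_big_dep /= (bigD1 (x0, y0)) //= [X in _ < X](bigD1 (x0, y0)) //=.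
  apply: ltr_leD; first exact: lt_gr.
  by apply: ler_sum => -[a b] /= /andP[eab _]; apply/ltW/lt_gr.
have -> : \sum_a \sum_(b | e a b) (#|V|%:R * g a b) = #|V|%:R * (2 * (weight p0 q0 e)%:R).
  by rewrite -Sg mulr_sumr; apply: eq_bigr => a _; rewrite mulr_sumr.
have -> : \sum_a \sum_(b | e a b) (K * r a b) = K * \sum_a \sum_(b | e a b) r a b.
  by rewrite mulr_sumr; apply: eq_bigr => a _; rewrite mulr_sumr.
have h1 := ler_wpM2l (ltW K0) Sr.
have h2 := ler_wpM2l (ler0n rat #|V|) Kw.
lra.
Qed.

Lemma leq_addP a b n : (a + b <= n)%N -> (a <= n)%N /\ (b <= n)%N.
Proof. by move=> abn; split; apply: leq_trans abn; rewrite ?leq_addr ?leq_addl. Qed.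

(** Combines [fmax_rec] with the vertex condition of a counterexample on [n.+1] vertices. *)
Lemma fmax_step_arith n P f f' t : ((n + P) * f <= n * f')%N ->
  (f' <= f + 1 + t)%N -> (P * f <= n.+1 * t + n.+1)%N.
Proof. by move=> *; nia. Qed.

(* Here [Sy * x] and [Qx] play the roles of the partial derivatives of Q at (x, y), [hQ]
   is h * Q (so [euler] is Euler's identity), and [taylor] says that moving k = kap * n
   vertices from one part to the other does not increase Q noticeably. *)
Lemma degree_arith (n c c' C C6 C7 hh P kap N Sy Qx hQ x y d : rat) :
  0 < n -> 0 < c -> 0 < c' -> 0 <= C -> 0 <= C7 -> 0 < kap ->
  0 <= P -> 0 < N -> 0 <= d ->
  hQ <= n * d * Sy + C6 * (n * N) ->
  hQ = x * Qx + y * x * Sy ->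
  (kap * n) * (x * Sy - Qx) <= P * (kap * n) ^+ 2 * N + C7 * (n * N) ->
  n - C <= x + y -> x <= n -> 0 <= y -> c * n <= x ->
  c' * N <= Sy -> Sy <= hh * N ->
  P * kap = c * c' / 8 ->
  8 / (c * c') * (C * hh + C7 / kap + C6) < n ->
  3 / 4 * x <= d.
Proof.
move=> n0 c0 c'0 C0 C70 k0 P0 N0 d0 min_deg euler taylor xyn xn y0 cx lS uS kapE large.
have x0 : 0 < x by apply: lt_le_trans cx; apply: mulr_gt0.
have S0 : 0 < Sy by apply: lt_le_trans lS; apply: mulr_gt0.
have kn : 0 < kap * n by apply: mulr_gt0.
(* This is [taylor] divided by [kap * n]. The value of [P * kap] makes its leading term half of the
   deficit [c * c' / 4] that [d < 3 / 4 * x] would create below. *)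
pose E := (c * c' / 8 * n + C7 / kap) * N.
have hE : x * Sy - Qx <= E.
  rewrite -(ler_pM2l kn); apply: le_trans taylor _.
  rewrite [leRHS](_ : _ = P * kap * n * (kap * n) * N + C7 * (n * N)).
    by rewrite expr2; lra.
  by rewrite /E -kapE; field; rewrite lt0r_neq0.
have cc0 : 0 < c * c' by apply: mulr_gt0.
have E0 : 0 <= E.
  have e1 : 0 <= c * c' / 8 * n by apply/ltW/mulr_gt0 => //; lra.
  have e2 : 0 <= C7 / kap by apply: divr_ge0 => //; apply: ltW.
  by apply: mulr_ge0; [lra | apply: ltW].
have {hE} h1 : x * (x * Sy) - n * E <= x * Qx.
  have e1 := ler_wpM2l (ltW x0) hE; have e2 := ler_wpM2r E0 xn; lra.
have h2 : (n - C) * (x * Sy) <= (x + y) * (x * Sy).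
  by apply: ler_wpM2r => //; rewrite mulr_ge0 ?ltW.
have h3 : n * ((x - d) * Sy) <= C * (x * Sy) + n * E + C6 * (n * N) by lra.
have h4 : C * (x * Sy) <= C * (n * (hh * N)).
  by apply: ler_wpM2l => //; apply: ler_pM => //; apply: ltW.
rewrite leNgt; apply/negP => dx.
have h5 : c * n / 4 * (c' * N) <= (x - d) * Sy.
  by apply: ler_pM => //; [rewrite divr_ge0 // mulr_ge0 ?ltW | rewrite mulr_ge0 ?ltW | lra].
have h6 := ler_wpM2l (ltW n0) h5.
have nN : 0 < n * N by apply: mulr_gt0.
have h7 : (c * c' * n / 4) * (n * N) <=
    (C * hh + c * c' / 8 * n + C7 / kap + C6) * (n * N).
  have h8 := le_trans h6 (le_trans h3 (lerD (lerD h4 (lexx _)) (lexx _))).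
  by move: h8; rewrite /E; lra.
rewrite ler_pM2r // in h7.
by move: large; rewrite mulrAC ltr_pdivrMr //; lra.
Qed.

Lemma Q_le_linear p0 q0 (x y n : rat) : 0 <= x -> 0 <= y -> x <= n -> y <= n ->
  Q p0 q0 x y <= 2 * x * n ^+ (p0 + q0).+1.
Proof.
move=> x0 y0 xn yn; have n0 : 0 <= n by apply: le_trans xn.
have term a b : x ^+ a.+1 * y ^+ b.+1 <= x * n ^+ (a + b).+1.
  rewrite exprS -mulrA ler_wpM2l // -addnS exprD.
  by apply: ler_pM; rewrite ?exprn_ge0 // lerXn2r ?nnegrE.
have h1 := term p0 q0; have h2 := term q0 p0.
by rewrite addnC in h2; rewrite /Q; lra.
Qed.

Lemma QC p0 q0 x y : Q p0 q0 x y = Q p0 q0 y x.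
Proof. by rewrite /Q; ring. Qed.

(** Euler's identity in degree [p + q]. The partial derivative in [y] appears with a factor [x]
    taken out, the form in which maps through a vertex are counted. *)
Lemma Q_homogeneous_euler p0 q0 (x y : rat) :
  (p0 + q0).+2%:R * Q p0 q0 x y =
  x * (p0.+1%:R * x ^+ p0 * y ^+ q0.+1 + q0.+1%:R * x ^+ q0 * y ^+ p0.+1)
  + y * x * (p0.+1%:R * (x ^+ q0 * y ^+ p0) + q0.+1%:R * (x ^+ p0 * y ^+ q0)).
Proof.
have -> : (p0 + q0).+2%:R = p0.+1%:R + q0.+1%:R :> rat by rewrite -natrD addSn addnS.
rewrite /Q !exprS; ring.
Qed.

(** * Degrees and codegrees in a counterexample *)

Section Main.
Variables (U : finType) (h : rel U) (side : pred U) (A B : {set U}) (pi : U -> U).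
Variables (a0 b0 : U) (p0 q0 : nat).
Hypothesis h_sym : symmetric h.
Hypothesis h_side : forall u w, h u w -> side u != side w.
Hypothesis A_side : forall a, a \in A -> side a.
Hypothesis B_side : forall b, b \in B -> ~~ side b.
Hypothesis AB : forall a b, a \in A -> b \in B -> h a b.
Hypothesis h_pi : forall u, h (pi u) u.
Hypothesis pi_AB : forall u, pi u \in A :|: B.
Hypothesis a0A : a0 \in A.
Hypothesis b0B : b0 \in B.
Hypothesis cardP : #|[set u | side u]| = p0.+1.
Hypothesis cardQ : #|[set u | ~~ side u]| = q0.+1.
Variables (W : finType) (hF : rel W) (c : pred W) (w1 w2 : W).
Hypothesis hF_c : forall u w, hF u w ->
  [|| c u != c w, (u == w1) && (w == w2) | (u == w2) && (w == w1)].
Hypothesis w12 : w1 != w2.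
Hypothesis cw1 : c w1.
Hypothesis cw2 : c w2.

Local Notation f_max := (fmax p0 q0).
Local Notation QQ := (Q p0 q0).

Definition through (V : finType) (e : rel V) v :=
  #|[set f in injs h e | [exists u, f u == v]]|.

(** The fourth clause is the lower bound on copies through a vertex that maximality provides in
    [injs_le_fmax]; its [+ 1] pays for the cardinality term of the maximized quantity. *)
Definition counterexample (V : finType) (e : rel V) :=
  [/\ symmetric e, irreflexive e, injs hF e = set0,
   forall v, (f_max #|V| <= f_max #|V|.-1 + 1 + through e v)%N &
   (f_max #|V| < #|injs h e|)%N].

Lemma card_U : #|U| = (p0 + q0).+2.
Proof.
rewrite -cardsT -(cardsID [set u | side u]) setTI cardP setTD.
have -> : ~: [set u | side u] = [set u | ~~ side u] by apply/setP => u; rewrite !inE.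
by rewrite cardQ addSn addnS.
Qed.

(** The vertex condition and [fmax_rec] bound [fmax] at one vertex fewer, and [Q_le_fmax] with slack
    1 compares [Q] with that value. *)
Lemma mindeg_injs : exists2 C : rat, 0 <= C & exists n0,
  forall (V : finType) (e : rel V), counterexample e -> (n0 <= #|V|)%N ->
  forall v (x y : rat), 0 <= x -> 0 <= y -> x + y <= #|V|%:R ->
  (p0 + q0).+2%:R * QQ x y <= #|V|%:R * (through e v)%:R + C * #|V|%:R ^+ (p0 + q0).+1.
Proof.
have [C C0 hC] := Q_le_fmax p0 q0 1.
exists ((p0 + q0).+2%:R * C + 1); first by rewrite addr_ge0 ?mulr_ge0 ?ler0n.
exists 2 => V e [_ _ _ md _] n2 v x y x0 y0 xy.
case En : #|V| n2 xy => [//|n] n2 xy; have n1 : (0 < n)%N by [].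
have nR : 1 <= n%:R :> rat by rewrite ler1n.
have Q1 := hC n x y n1 x0 y0 ltac:(by rewrite -natrD addn1).
have rec := fmax_rec p0 q0 n; have := md v; rewrite En /= => mdv.
have {rec mdv} H : ((p0 + q0).+2 * f_max n <= n.+1 * through e v + n.+1)%N.
  have E : (p0.+1 + q0.+1 = (p0 + q0).+2)%N by rewrite addSn addnS.
  by rewrite E in rec; apply: fmax_step_arith rec mdv.
rewrite -(ler_nat rat) natrD !natrM in H.
have T1 : n%:R ^+ (p0 + q0).+1 <= n.+1%:R ^+ (p0 + q0).+1 :> rat.
  by rewrite lerXn2r ?nnegrE ?ler0n // ler_nat.
have T2 : n.+1%:R <= n.+1%:R ^+ (p0 + q0).+1 :> rat.
  by rewrite exprS ler_peMr ?ler0n // exprn_ege1 // ler1n.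
have k1 := ler_wpM2l C0 T1.
have k2 := ler_wpM2l (ler0n rat (p0 + q0).+2) (le_trans Q1 (lerD (lexx _) k1)).
lra.
Qed.

Definition homs_at (V : finType) (e : rel V) u v := [set f in homs h e | f u == v].

Lemma through_le (V : finType) (e : rel V) v : (through e v <= \sum_u #|homs_at e u v|)%N.
Proof.
apply: leq_trans (leq_card_bigcup _ _); apply/subset_leq_card/subsetP => f.
by rewrite !inE -andbA => /and3P[fh _ /existsP[u fu]]; apply/bigcupP; exists u; rewrite // !inE fh.
Qed.

Lemma h_irr u : h u u = false.
Proof. by apply/negP => /h_side; rewrite eqxx. Qed.

Lemma pi_neq u : u != pi u.
Proof. by apply: contraTneq (h_pi u) => <-; rewrite h_irr. Qed.

(** If [u] goes to [v], then [pi u] goes to a neighbour of [v] and the remaining vertices are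
    free. *)
Lemma through_deg (V : finType) (e : rel V) v : symmetric e ->
  (through e v <= (p0 + q0).+2 * (deg e v * #|V| ^ (p0 + q0)))%N.
Proof.
move=> e_sym; apply: leq_trans (through_le e v) _.
rewrite -card_U -sum_nat_const; apply: leq_sum => u _.
apply: leq_trans (leq_card_pair (D := [set (v, w) | w in [set w | e v w]]) (pi_neq u) _) _.
  move=> f; rewrite inE => /andP[/homsP fh /eqP fu]; apply/imsetP; exists (f (pi u)).
    by rewrite inE e_sym -fu fh.
  by rewrite fu.
by rewrite card_U subn2 leq_mul2r; apply/orP; right; apply: leq_imset_card.
Qed.

(** Compare [mindeg_injs] at the balanced point with [through_deg]. *)
Lemma mindeg : exists2 cd : rat, 0 < cd & exists n0,
  forall (V : finType) (e : rel V), counterexample e -> (n0 <= #|V|)%N ->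
  forall v, cd * #|V|%:R <= (deg e v)%:R.
Proof.
have [C C0 [n0 hC]] := mindeg_injs.
pose r : rat := 2^-1 ^+ (p0 + q0).+1.
have r0 : 0 < r by apply: exprn_gt0.
have [n1 hn1] := eventually_ge (2 * C / r).
exists (r / 2); first by rewrite divr_gt0.
exists (n0 + n1.+1)%N => V e ge nV v.
have [nV0 nV1] := leq_addP nV; have := hn1 _ (ltnW nV1).
rewrite ler_pdivrMr // => nC.
have n_pos : 0 < #|V|%:R :> rat by rewrite ltr0n; apply: leq_ltn_trans nV1.
have := hC V e ge nV0 v (#|V|%:R / 2) (#|V|%:R / 2) ltac:(lra) ltac:(lra) ltac:(lra).
have -> : QQ (#|V|%:R / 2) (#|V|%:R / 2) = r * #|V|%:R * #|V|%:R * #|V|%:R ^+ (p0 + q0).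
  by rewrite /Q -!exprD [(q0.+1 + _)%N]addnC addSn addnS exprMn /r !exprS; field.
have [es _ _ _ _] := ge.
have := through_deg v es; rewrite -(ler_nat rat) !natrM natrX => td.
have k := ler_wpM2l (ltW n_pos) td.
move=> H; have {k td} H := le_trans H (lerD k (lexx _)).
set n := #|V|%:R in n_pos nC H *; set D := (deg e v)%:R in H *.
have T0 : 0 < n ^+ (p0 + q0) by apply: exprn_gt0.
set T := n ^+ (p0 + q0) in T0 H; set HH := (p0 + q0).+2%:R in H.
have nT : 0 < n * T by apply: mulr_gt0.
have {}H : (HH * (r * n)) * (n * T) <= (HH * D + C) * (n * T).
  by move: H; rewrite exprS -/T; lra.
rewrite ler_pM2r // in H.
have H2 : 1 <= HH by rewrite ler1n.
have rn : 2 * C <= r * n by lra.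
have : HH * (r * n) <= HH * D + HH * (r * n / 2).
  by apply: le_trans H _; rewrite lerD2l; nra.
have HH0 : 0 < HH by lra.
by move=> H3; rewrite -(ler_pM2l HH0); lra.
Qed.

Lemma codegree : exists2 L : rat, 0 <= L & exists n0,
  forall (V : finType) (e : rel V), counterexample e -> (n0 <= #|V|)%N ->
  forall x y, e x y -> #|[set z | e x z && e y z]|%:R <= L.
Proof.
have [cd cd0 [n0 hd]] := mindeg.
have [k Wk] : exists k, #|W| = k.+1.
  by exists #|W|.-1; rewrite prednK //; apply/card_gt0P; exists w1.
(* This is the bound of [codegree_bound] when the falling factorial is at least
   [(cd / 2 * n) ^+ #|W|]; the threshold [n1] lets half of the minimum degree absorb rounding and
   the subtracted constants. *)
exists (k.+1%:R / (cd / 2) ^+ k.+1); first by rewrite divr_ge0 ?ler0n // exprn_ge0; lra.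
have [n1 hn1] := eventually_ge (2 * k.+3%:R / cd).
exists (n0 + n1.+1)%N => V e ge nV x y exy.
have [nV0 nV1] := leq_addP nV; have := hn1 _ (ltnW nV1).
rewrite ler_pdivrMr // => nC.
have n_pos : 0 < #|V|%:R :> rat by rewrite ltr0n; apply: leq_ltn_trans nV1.
have [es ei ff _ _] := ge.
have c0 : 0 < cd * #|V|%:R by apply: mulr_gt0.
pose d := Num.truncn (cd * #|V|%:R).
have /andP[t1 t2] := truncn_itv (ltW c0).
have dd v : (d <= deg e v)%N.
  by rewrite -(ler_nat rat); apply: le_trans t1 _; apply: hd.
have f1 : (cd / 2 * #|V|%:R) ^+ k.+1 <= ((d - 2) ^_ k.+1)%:R.
  apply: le_trans (_ : (d - 2 - k)%:R ^+ k.+1 <= _); last first.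
    by rewrite -natrX ler_nat leq_exp_ffact.
  rewrite lerXn2r ?nnegrE ?ler0n //; first by rewrite mulr_ge0 // ltW // divr_gt0.
  have e1 : (d.+1 <= d - 2 - k + k.+3)%N by rewrite -subnDA addnS ltnS addnC -leq_subLR leq_sub2l // add2n.
  have : d.+1%:R <= (d - 2 - k)%:R + k.+3%:R :> rat by rewrite -natrD ler_nat.
  by rewrite -/d in t2; lra.
have := codegree_bound hF_c w12 es ei ff cw1 cw2 dd exy; rewrite Wk.
move: f1; move: ((d - 2) ^_ k.+1)%N => FF f1.
set m := #|[set z | _]| => H.
have {}H : m%:R * FF%:R <= k.+1%:R * #|V|%:R ^+ k.+1 :> rat.
  by rewrite -natrX -!natrM ler_nat.
have P0 : 0 < (cd / 2) ^+ k.+1 by rewrite exprn_gt0 // divr_gt0.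
rewrite ler_pdivlMr // -(ler_pM2r (exprn_gt0 k.+1 n_pos)) -mulrA -exprMn.
by apply: le_trans H; apply: ler_wpM2l f1; apply: ler0n.
Qed.

(** Take the edge from [heavy_edge]. If its degree sum is below [n], scale the two degrees by [rho]
    so that they sum to [n]. Homogeneity gives a value of [Q] at least [rho * fmax n], while
    [Q_le_fmax] allows only a lower-order excess, so [rho - 1] is of order [1 / n]. *)
Lemma heavy_degrees : exists2 C : rat, 0 <= C & exists n0,
  forall (V : finType) (e : rel V), counterexample e -> (n0 <= #|V|)%N ->
  exists a b, e a b /\ #|V|%:R - C <= (deg e a)%:R + (deg e b)%:R.
Proof.
have [C C0 hC] := Q_le_fmax p0 q0 0.
have [cf cf0 [n0 hf]] := fmax_ge p0 q0.
exists (C / cf); first by rewrite divr_ge0 // ltW.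
exists n0.+1 => V e ge nV.
have V0 : (0 < #|V|)%N by apply: leq_trans nV.
have n_pos : 0 < #|V|%:R :> rat by rewrite ltr0n.
have [es ei _ _ inj_gt] := ge.
have fh := hf #|V| (ltnW nV).
pose K : rat := #|homs h e|%:R.
have injK : (#|injs h e| <= #|homs h e|)%N.
  by apply/subset_leq_card/subsetP => f; rewrite inE => /andP[].
have fK : (f_max #|V|)%:R <= K by rewrite ler_nat ltnW // (leq_trans inj_gt).
have hom0 : (0 < #|homs h e|)%N := leq_trans (leq_ltn_trans (leq0n _) inj_gt) injK.
have K0 : 0 < K by rewrite ltr0n.
have [f fH] : exists f, f \in homs h e by apply/card_gt0P.
have Kw : K <= (weight p0 q0 e)%:R.
  by rewrite ler_nat; apply: (homs_weight h_side A_side B_side AB h_pi pi_AB a0A b0B cardP cardQ es).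
have ex : exists x y, e x y by exists (f a0), (f b0); apply: (homsP h e f fH); apply: AB.
have [a [b [eab H]]] := heavy_edge es K0 Kw ex.
exists a, b; split => //.
have dpos x y : e x y -> 0 < (deg e x)%:R :> rat.
  by move=> exy; rewrite ltr0n; apply/card_gt0P; exists y; rewrite inE.
have da := dpos _ _ eab; have db : 0 < (deg e b)%:R :> rat by apply: (dpos b a); rewrite es.
move: (deg e a)%:R (deg e b)%:R da db H => x y x0 y0 H.
set n := #|V|%:R in n_pos fh hC fK H *.
have m0 : 0 < x + y by lra.
have [nm|mn] := leP n (x + y); first by apply: le_trans nm; rewrite gerBl divr_ge0 // ltW.
have [rho rhoE] : exists r, r = n / (x + y) by exists (n / (x + y)).
have rho1 : 1 <= rho by rewrite rhoE ler_pdivlMr // mul1r ltW.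
have := hC #|V| (rho * x) (rho * y) V0 ltac:(apply: mulr_ge0; lra) ltac:(apply: mulr_ge0; lra).
rewrite -mulrDr rhoE mulfVK ?lt0r_neq0 // addr0 -/n => /(_ (lexx _)).
rewrite -rhoE.
have -> : QQ (rho * x) (rho * y) = rho ^+ (p0 + q0).+1 * (rho * QQ x y).
  by rewrite /Q !exprMn !exprS exprD; ring.
have h1 : (f_max #|V|)%:R <= rho * QQ x y.
  rewrite rhoE mulrAC ler_pdivlMr //; apply: le_trans H.
  by rewrite ler_wpM2r // ltW.
have h2 : rho <= rho ^+ (p0 + q0).+1 by rewrite exprS ler_peMr ?exprn_ege1 //; lra.
have F0 : 0 <= (f_max #|V|)%:R :> rat by apply: ler0n.
have h3 : rho * (f_max #|V|)%:R <= rho ^+ (p0 + q0).+1 * (rho * QQ x y).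
  by apply: ler_pM => //; lra.
move=> h4; have {h3 h4} h5 := le_trans h3 h4.
have h6 : (n - (x + y)) / n <= rho - 1.
  have -> : rho - 1 = (n - (x + y)) / (x + y) by rewrite rhoE; field; rewrite lt0r_neq0.
  by rewrite ler_wpM2l ?subr_ge0 ?(ltW mn) // lef_pV2 ?posrE // ltW.
have h7 : (n - (x + y)) / n * (f_max #|V|)%:R <= C * n ^+ (p0 + q0).+1.
  by apply: le_trans (ler_wpM2r F0 h6) _; lra.
have g0 : 0 <= (n - (x + y)) / n by rewrite divr_ge0 ?subr_ge0 ?(ltW mn) ?(ltW n_pos).
have := le_trans (ler_wpM2l g0 fh) h7.
have T0 : 0 < n ^+ (p0 + q0).+1 by apply: exprn_gt0.
have -> : (n - (x + y)) / n * (cf * n ^+ (p0 + q0).+2) = ((n - (x + y)) * cf) * n ^+ (p0 + q0).+1.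
  by rewrite [n ^+ (p0 + q0).+2]exprS; field; rewrite lt0r_neq0.
rewrite ler_pM2r // -ler_pdivlMr //; lra.
Qed.
(** * Structure of a counterexample *)

Definition near_bip (C : rat) (V : finType) (e : rel V) (X Y : {set V}) :=
  [/\ [disjoint X & Y], #|V|%:R - C <= #|X|%:R + #|Y|%:R,
      forall v, v \in X -> #|[set w in X | e v w]|%:R <= C &
      forall v, v \in Y -> #|[set w in Y | e v w]|%:R <= C].

Lemma near_bipC C (V : finType) (e : rel V) X Y : near_bip C e X Y -> near_bip C e Y X.
Proof. by case=> d s iX iY; split=> //; [rewrite disjoint_sym | rewrite [leRHS]addrC]. Qed.

(** The parts are the neighbourhoods of the ends of a heavy edge, with common neighbours left in the
    second. Neighbours of [v] inside a part are common neighbours of [v] and an end, hence boundedly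
    many. *)
Lemma near_bip_exists : exists2 C : rat, 0 <= C & exists n0,
  forall (V : finType) (e : rel V), counterexample e -> (n0 <= #|V|)%N ->
  exists X Y, near_bip C e X Y.
Proof.
have [L L0 [n0 hL]] := codegree; have [C C0 [n1 hC]] := heavy_degrees.
exists (C + L); first by rewrite addr_ge0.
exists (n0 + n1)%N => V e ge nV; have [nV0 nV1] := leq_addP nV.
have [a [b [eab dab]]] := hC V e ge nV1.
have [es ei _ _ _] := ge.
exists ([set w | e a w] :\: [set w | e b w]), [set w | e b w]; split.
- by rewrite -setI_eq0; apply/eqP/setP => w; rewrite !inE; case: (e b w); rewrite ?andbF.
- have := hL V e ge nV0 a b eab.
  rewrite cardsD natrB ?subset_leq_card ?subsetIl //.
  have -> : [set w | e a w] :&: [set w | e b w] = [set z | e a z && e b z].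
    by apply/setP => z; rewrite !inE.
  rewrite -/(deg e a) -/(deg e b); lra.
- move=> v; rewrite !inE => /andP[_ av].
  apply: le_trans (_ : L <= _); last by rewrite lerDr.
  apply: le_trans (hL V e ge nV0 a v av); rewrite ler_nat.
  by apply/subset_leq_card/subsetP => w; rewrite !inE => /andP[/andP[_ ->] ->].
- move=> v; rewrite !inE => bv.
  apply: le_trans (_ : L <= _); last by rewrite lerDr.
  apply: le_trans (hL V e ge nV0 b v bv); rewrite ler_nat.
  by apply/subset_leq_card/subsetP => w; rewrite !inE.
Qed.

Definition cross (V : finType) (X Y : {set V}) x y :=
  (x \in X) && (y \in Y) || (x \in Y) && (y \in X).

Definition uncrossed (V : finType) (e : rel V) (X Y : {set V}) : {set V * V} :=
  [set xy | e xy.1 xy.2 && ~~ cross X Y xy.1 xy.2].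

Lemma card_pairs (V : finType) (r : rel V) :
  #|[set xy : V * V | r xy.1 xy.2]| = (\sum_x #|[set y | r x y]|)%N.
Proof.
rewrite -sum1dep_card -(pair_big_dep predT r (fun _ _ => 1%N)) /=.
by apply: eq_bigr => x _; rewrite sum1dep_card.
Qed.

(** Each part contributes at most [C * n] ordered pairs, and the at most [C] leftover vertices occur
    in at most [2 * C * n]. *)
Lemma card_uncrossed (C : rat) (V : finType) (e : rel V) X Y : 0 <= C ->
  near_bip C e X Y -> #|uncrossed e X Y|%:R <= 4 * C * #|V|%:R.
Proof.
move=> C0 [dXY s iX iY].
have fin (a b r n : rat) : a <= C * n -> b <= C * n -> r * n <= C * n ->
    a + b + (r * n + r * n) <= 4 * C * n by lra.
pose R := ~: (X :|: Y).
have RC : #|R|%:R <= C.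
  have := cardsC (X :|: Y); rewrite -/R cardsU.
  have -> : X :&: Y = set0 by apply/eqP; rewrite setI_eq0.
  rewrite cards0 subn0 => E.
  have : (#|X| + #|Y| + #|R|)%:R = #|V|%:R :> rat by rewrite E.
  rewrite !natrD; lra.
pose inside (Z : {set V}) := [set xy : V * V | (xy.1 \in Z) && ((xy.2 \in Z) && e xy.1 xy.2)].
have cin (Z : {set V}) : (forall v, v \in Z -> #|[set w in Z | e v w]|%:R <= C) ->
    #|inside Z|%:R <= C * #|V|%:R.
  move=> iZ; rewrite (card_pairs (fun x y => (x \in Z) && ((y \in Z) && e x y))) natr_sum.
  rewrite mulrC mulr_natl -sumr_const; apply: ler_sum => x _.
  have [xZ|xZ] := boolP (x \in Z); first exact: iZ.
  by rewrite (_ : [set y | _] = set0) ?cards0 //; apply/setP => y; rewrite !inE.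
have sub : uncrossed e X Y \subset inside X :|: inside Y :|: (setX R setT :|: setX setT R).
  apply/subsetP => -[x y]; rewrite !inE /= /cross.
  have /pred0P dx := dXY; have := dx x; have := dx y; rewrite /=.
  by case: (x \in X) (x \in Y) (y \in X) (y \in Y) (e x y) => [] [] [] [] [].
have := subset_leq_card sub; rewrite -(ler_nat rat) => H; apply: le_trans H _.
have u1 := leq_card_setU (inside X :|: inside Y) (setX R setT :|: setX setT R).
have u2 := leq_card_setU (inside X) (inside Y).
have u3 := leq_card_setU (setX R [set: V]) (setX [set: V] R).
have {u1 u2 u3} := leq_trans u1 (leq_add u2 u3).
rewrite !cardsX cardsT [(#|V| * #|R|)%N]mulnC -(ler_nat rat) !natrD !natrM => H.
have h1 := cin X iX; have h2 := cin Y iY.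
have h3 := ler_wpM2r (ler0n rat #|V|) RC.
apply: le_trans H _; exact: fin h1 h2 h3.
Qed.

(* H is connected, so a proper 2-colouring t of H is either side or its negation. *)
Lemma two_sides_at (t1 t2 : pred U) :
  (forall u w, h u w -> t1 u && t2 w || t2 u && t1 w) ->
  (forall u, ~~ (t1 u && t2 u)) -> t1 a0 ->
  (forall u, if side u then t1 u else t2 u).
Proof.
move=> ht tx ta0.
have n12 u : t1 u -> t2 u = false by move=> H; have := tx u; rewrite H => /negPf.
have n21 u : t2 u -> t1 u = false by move=> H; have := tx u; rewrite H andbT => /negPf.
have h12 u w : h u w -> t1 u -> t2 w.
  by move=> /ht /orP[/andP[]|/andP[t2u _]] // /n12; rewrite t2u.
have h21 u w : h u w -> t2 u -> t1 w.
  by move=> /ht /orP[/andP[t1u _]|/andP[]] // /n21; rewrite t1u.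
have tB b : b \in B -> t2 b by move=> bB; apply: h12 ta0; apply: AB.
have tA a : a \in A -> t1 a.
  by move=> aA; apply: (h21 b0); [rewrite h_sym AB | apply: tB].
move=> u; case: ifP => su.
  by apply: (h21 _ _ (h_pi u)); apply/tB/(pi_B h_side A_side h_pi pi_AB).
by apply: (h12 _ _ (h_pi u)); apply/tA/(pi_A h_side B_side h_pi pi_AB); rewrite su.
Qed.

Lemma two_sides (t1 t2 : pred U) :
  (forall u w, h u w -> t1 u && t2 w || t2 u && t1 w) ->
  (forall u, ~~ (t1 u && t2 u)) ->
  (forall u, if side u then t1 u else t2 u) \/ (forall u, if side u then t2 u else t1 u).
Proof.
move=> ht tx; have := ht _ _ (AB a0A b0B) => /orP[/andP[ta _]|/andP[ta _]].
  by left; apply: two_sides_at.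
right; apply: two_sides_at => // u.
  by move=> w /ht; rewrite orbC.
by rewrite andbC.
Qed.

Lemma prod_sides (x y : nat) (P : pred U) :
  (\prod_(u | P u) (if side u then x else y) =
   x ^ #|[set u | P u && side u]| * y ^ #|[set u | P u && ~~ side u]|)%N.
Proof.
rewrite (bigID side) /=; congr (_ * _)%N.
  rewrite (eq_bigr (fun=> x)) => [|u /andP[_ ->] //].
  by rewrite prod_nat_const; congr (_ ^ _)%N; apply: eq_card => u; rewrite !inE.
rewrite (eq_bigr (fun=> y)) => [|u /andP[_ /negPf->] //].
by rewrite prod_nat_const; congr (_ ^ _)%N; apply: eq_card => u; rewrite !inE.
Qed.

Lemma card_side1 u : side u -> #|[set w | (w != u) && side w]| = p0.
Proof.
move=> su; have := cardsD1 u [set w | side w]; rewrite cardP inE su => -[->].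
by apply: eq_card => w; rewrite !inE.
Qed.

Lemma card_nside1 u : ~~ side u -> #|[set w | (w != u) && ~~ side w]| = q0.
Proof.
move=> su; have := cardsD1 u [set w | ~~ side w]; rewrite cardQ inE su => -[->].
by apply: eq_card => w; rewrite !inE.
Qed.

(** Either some edge of H has an uncrossed image, or by [two_sides] the map respects the bipartition
    in one of two orientations. In one orientation the edge [a0 b0] is confined to actual edges,
    which will make missing pairs count; the other is bounded trivially. *)
Lemma homs_near_bip (V : finType) (e : rel V) (X Y : {set V}) : symmetric e ->
  [disjoint X & Y] ->
  (#|homs h e| <= #|U| * (#|U| * (#|uncrossed e X Y| * #|V| ^ (p0 + q0)))
     + (#|[set xy : V * V | [&& xy.1 \in X, xy.2 \in Y & e xy.1 xy.2]]| * (#|X| ^ p0 * #|Y| ^ q0)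
     + #|Y| ^ p0.+1 * #|X| ^ q0.+1))%N.
Proof.
move=> e_sym dXY; set E := [set xy | _].
pose bad u w := [set f in homs h e | h u w && ((f u, f w) \in uncrossed e X Y)].
pose G1 := [set f in homs h e | [forall u, f u \in if side u then X else Y]].
pose G2 := [set f in homs h e | [forall u, f u \in if side u then Y else X]].
have sub : homs h e \subset (\bigcup_u \bigcup_w bad u w) :|: (G1 :|: G2).
  apply/subsetP => f fH; rewrite in_setU in_setU [f \in G1]inE [f \in G2]inE fH /=.
  have [/existsP[u /existsP[w uw]]|NB] :=
      boolP [exists u, exists w, h u w && ((f u, f w) \in uncrossed e X Y)].
    by apply/orP; left; apply/bigcupP; exists u => //; apply/bigcupP; exists w; rewrite // inE fH.
  apply/orP; right.
  have cr u w : h u w -> cross X Y (f u) (f w).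
    move=> uw; move: NB => /existsPn/(_ u)/existsPn/(_ w); rewrite uw /= inE /=.
    by rewrite (homsP h e f fH _ _ uw) /= negbK.
  have [||H|H] := @two_sides (fun u => f u \in X) (fun u => f u \in Y).
  - by move=> u w /cr.
  - by move=> u; have /pred0P/(_ (f u)) /= -> := dXY.
  - by apply/orP; left; apply/forallP => u; have := H u; case: ifP.
  - by apply/orP; right; apply/forallP => u; have := H u; case: ifP.
apply: leq_trans (subset_leq_card sub) _.
apply: leq_trans (leq_card_setU _ _) _; apply: leq_add; last first.
  apply: leq_trans (leq_card_setU _ _) _; apply: leq_add.
    have ab : a0 != b0 by apply: contraTneq (AB a0A b0B) => ->; rewrite h_irr.
    apply: leq_trans (leq_card_family_pair (F := fun u => if side u then X else Y)
      (D := E) ab _ _) _.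
    - move=> f; rewrite inE => /andP[fH /forallP fs]; rewrite inE /=.
      have := fs a0; have := fs b0; rewrite (A_side a0A) (negPf (B_side b0B)) => -> ->.
      by rewrite (homsP h e f fH) ?AB.
    - by move=> f; rewrite inE => /andP[_ /forallP fs] u _ _; apply: fs.
    rewrite leq_mul2l; apply/orP; right.
    rewrite (eq_bigr (fun u => if side u then #|X| else #|Y|)) => [|u _]; last by case: ifP.
    rewrite prod_sides.
    have -> : #|[set u | (u != a0) && (u != b0) && side u]| = p0.
      rewrite -(card_side1 (A_side a0A)); apply: eq_card => u; rewrite !inE.
      have [->|_] := eqVneq u b0; last by rewrite andbT.
      by rewrite (negPf (B_side b0B)) !andbF.
    have -> // : #|[set u | (u != a0) && (u != b0) && ~~ side u]| = q0.
    rewrite -(card_nside1 (B_side b0B)); apply: eq_card => u; rewrite !inE.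
    have [->|_] //= := eqVneq u a0.
    by rewrite (A_side a0A) !andbF.
  apply: leq_trans (leq_card_family (F := fun u => if side u then Y else X) _) _.
    by move=> f; rewrite inE => /andP[_ /forallP].
  rewrite (eq_bigr (fun u => if side u then #|Y| else #|X|)) => [|u _]; last by case: ifP.
  by rewrite prod_sides /= cardP cardQ.
apply: leq_trans (leq_card_bigcup _ _) _.
rewrite -[X in (_ <= X)%N]sum_nat_const; apply: leq_sum => u _.
apply: leq_trans (leq_card_bigcup _ _) _.
rewrite -[X in (_ <= X)%N]sum_nat_const; apply: leq_sum => w _.
have [uw|uw] := boolP (h u w); last first.
  by rewrite (_ : bad u w = set0) ?cards0 //; apply/setP => f; rewrite !inE (negPf uw) andbF.
have neq : u != w by apply: contraTneq uw => ->; rewrite h_irr.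
apply: leq_trans (leq_card_pair (D := uncrossed e X Y) neq _) _.
  by move=> f; rewrite inE => /and3P[].
by rewrite card_U subn2.
Qed.

(** The same classification with [u] sent to [v]: a neighbour of [u] leaves [X], or an edge avoiding
    [u] is uncrossed, or the rest respects the bipartition and [pi u] lands in the neighbours of [v]
    in [X]. The factor [#|V|] avoids an exponent one below [p0 + q0] in the second case. *)
Lemma homs_at_near_bip (V : finType) (e : rel V) (X Y : {set V}) u v : symmetric e ->
  [disjoint X & Y] ->
  (#|V| * #|homs_at e u v| <=
     #|V| * (#|U| * (#|[set w | e v w && (w \notin X)]| * #|V| ^ (p0 + q0)))
     + #|U| * (#|U| * (#|uncrossed e X Y| * #|V| ^ (p0 + q0)))
     + #|V| * (#|[set w in X | e v w]| *
         (if side u then #|X| ^ q0 * #|Y| ^ p0 else #|X| ^ p0 * #|Y| ^ q0)))%N.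
Proof.
move=> e_sym dXY; set N1 := [set w | _ && _]; set N2 := [set w in X | _].
pose bad1 w := [set f in homs_at e u v | h u w && (f w \notin X)].
pose bad2 w w' := [set f in homs_at e u v |
  [&& h w w', w != u, w' != u & (f w, f w') \in uncrossed e X Y]].
pose G := [set f in homs_at e u v | [forall w, f w \in
   if w == u then [set v] else if w == pi u then N2 else
   if side w == side u then Y else X]].
have sub : homs_at e u v \subset (\bigcup_w bad1 w) :|: (\bigcup_w \bigcup_w' bad2 w w') :|: G.
  apply/subsetP => f fA; have := fA; rewrite inE => /andP[fH /eqP fu].
  rewrite !in_setU.
  have [/existsP[w uw]|NB1] := boolP [exists w, h u w && (f w \notin X)].
    by apply/orP; left; apply/orP; left; apply/bigcupP; exists w; rewrite // inE fA.
  have [/existsP[w /existsP[w' ww]]|NB2] := boolP [exists w, exists w',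
     [&& h w w', w != u, w' != u & (f w, f w') \in uncrossed e X Y]].
    apply/orP; left; apply/orP; right; apply/bigcupP; exists w => //.
    by apply/bigcupP; exists w'; rewrite // inE fA.
  apply/orP; right.
  have uX w : h u w -> f w \in X.
    by move=> uw; move: NB1 => /existsPn/(_ w); rewrite uw /= negbK.
  have cr w w' : h w w' -> w != u -> w' != u -> cross X Y (f w) (f w').
    move=> ww wu w'u; move: NB2 => /existsPn/(_ w)/existsPn/(_ w').
    by rewrite ww wu w'u /= inE /= (homsP h e f fH _ _ ww) negbK.
  have /pred0P dX := dXY.
  (* The position of [v] is unknown, so [u] is declared to lie opposite to [X], where its neighbours
     go. *)
  pose t1 w := (w != u) && (f w \in X); pose t2 w := (w == u) || (f w \in Y).
  have [||H|H] := @two_sides t1 t2; rewrite /t1 /t2.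
  - move=> w w' ww; have [wu|wu] := eqVneq w u.
      have w'u : w' != u by apply: contraTneq ww => ->; rewrite wu h_irr.
      by rewrite w'u /= uX // -wu.
    have [w'u|w'u] := eqVneq w' u; last by have := cr _ _ ww wu w'u.
    by rewrite uX // -w'u h_sym.
  - move=> w; case: eqVneq => //= _; exact: negbT (dX (f w)).
  - have su : ~~ side u by have := H u; rewrite /t1 eqxx; case: (side u).
    rewrite inE fA; apply/forallP => w; have := H w; rewrite /t1 /t2 (negPf su).
    have [->|wu] /= := eqVneq w u; first by rewrite fu inE.
    have [->|wp] := eqVneq w (pi u).
      by rewrite inE uX ?[h u _]h_sym // -fu (homsP h e f fH) // h_sym.
    by case: (side w).
  - have su : side u by have := H u; rewrite /t1 /t2 eqxx; case: (side u).
    rewrite inE fA; apply/forallP => w; have := H w; rewrite /t1 /t2 su.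
    have [->|wu] /= := eqVneq w u; first by rewrite fu inE.
    have [->|wp] := eqVneq w (pi u).
      by rewrite inE uX ?[h u _]h_sym // -fu (homsP h e f fH) // h_sym.
    by case: (side w).
apply: leq_trans (leq_mul (leqnn _) (subset_leq_card sub)) _.
apply: leq_trans (leq_mul (leqnn _) (leq_card_setU _ _)) _; rewrite mulnDr; apply: leq_add.
  apply: leq_trans (leq_mul (leqnn _) (leq_card_setU _ _)) _; rewrite mulnDr; apply: leq_add.
    rewrite leq_mul2l; apply/orP; right.
    apply: leq_trans (leq_card_bigcup _ _) _.
    rewrite -[X in (_ <= X)%N]sum_nat_const; apply: leq_sum => w _.
    have [uw|uw] := boolP (h u w); last first.
      by rewrite (_ : bad1 w = set0) ?cards0 //; apply/setP => f; rewrite !inE (negPf uw) andbF.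
    have neq : u != w by apply: contraTneq uw => ->; rewrite h_irr.
    apply: leq_trans (leq_card_pair (D := [set (v, w) | w in N1]) neq _) _.
      move=> f; rewrite [f \in _]inE [f \in homs_at _ _ _]inE.
      move=> /andP[/andP[/homsP fH /eqP fu] /andP[_ fX]].
      by rewrite fu; apply: imset_f; rewrite inE fX -fu fH.
    by rewrite card_U subn2 leq_mul2r leq_imset_card orbT.
  apply: leq_trans (leq_mul (leqnn _) (leq_card_bigcup _ _)) _.
  rewrite big_distrr -[X in (_ <= X)%N]sum_nat_const; apply: leq_sum => w _ /=.
  apply: leq_trans (leq_mul (leqnn _) (leq_card_bigcup _ _)) _.
  rewrite big_distrr -[X in (_ <= X)%N]sum_nat_const; apply: leq_sum => w' _ /=.
  have [/and3P[ww wu w'u]|ww] := boolP [&& h w w', w != u & w' != u]; last first.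
    rewrite (_ : bad2 w w' = set0) ?cards0 ?muln0 //; apply/setP => f; rewrite !inE.
    by case: (h w w') ww => //=; case: (w != u) => //=; case: (w' != u) => //=; rewrite ?andbF.
  have neq : w != w' by apply: contraTneq ww => ->; rewrite h_irr.
  pose F t := if t == u then [set v] else [set: V].
  have := leq_card_family_pair (S := bad2 w w') (F := F) (D := uncrossed e X Y) neq
    ltac:(by move=> f; rewrite inE => /and5P[]).
  move/(_ _)/(leq_mul (leqnn #|V|)) => H; apply: leq_trans (H _) _ => {H}.
    move=> f; rewrite !inE => /andP[/andP[_ fu] _] t _ _; rewrite /F.
    by case: eqVneq => [->|_]; rewrite inE.
  rewrite mulnCA leq_mul2l; apply/orP; right.
  have uP : (u != w) && (u != w') by rewrite ![u == _]eq_sym wu w'u.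
  rewrite (bigD1 u) //= /F eqxx cards1 mul1n.
  rewrite (eq_bigr (fun=> #|V|)) => [|t /andP[_ /negPf->]]; last by rewrite cardsT.
  (* The extra factor [#|V|] stands in for the fixed image of [u]. *)
  have -> : (#|V| * \prod_(t | (t != w) && (t != w') && (t != u)) #|V| =
     \prod_(t | (t != w) && (t != w')) #|V|)%N by rewrite [RHS](bigD1 u).
  rewrite prod_nat_const.
  suff -> : #|[pred t | (t != w) && (t != w')]| = (p0 + q0)%N by [].
  have := cardC [pred t | (t != w) && (t != w')]; rewrite card_U.
  have -> : #|[predC [pred t | (t != w) && (t != w')]]| = #|[set w; w']|.
    by apply: eq_card => t; rewrite !inE negb_and !negbK.
  by rewrite cards2 neq addn2 => -[].
rewrite leq_mul2l; apply/orP; right.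
apply: leq_trans (leq_card_family (F := fun w => if w == u then [set v] else
   if w == pi u then N2 else if side w == side u then Y else X) _) _.
  by move=> f; rewrite inE => /andP[_ /forallP].
have piu : pi u != u by rewrite eq_sym pi_neq.
rewrite (bigD1 u) //= (bigD1 (pi u)) //= eqxx (negPf piu) eqxx cards1 mul1n leq_mul2l.
apply/orP; right.
have sp : side (pi u) = ~~ side u.
  by have := h_side (h_pi u); case: (side u) (side (pi u)) => [] [].
have [su|su] := boolP (side u).
  rewrite (eq_bigr (fun w => if side w then #|Y| else #|X|)) => [|w /andP[/negPf-> /negPf->]]; last first.
    by case: (side w).
  rewrite prod_sides mulnC.
  have -> : #|[set w | (w != u) && (w != pi u) && side w]| = p0.
    rewrite -(card_side1 su); apply: eq_card => w; rewrite !inE.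
    have [->|_] := eqVneq w (pi u); last by rewrite andbT.
    by rewrite sp su !andbF.
  have -> // : #|[set w | (w != u) && (w != pi u) && ~~ side w]| = q0.
  have spn : ~~ side (pi u) by rewrite sp su.
  rewrite -(card_nside1 spn); apply: eq_card => w; rewrite !inE.
  by have [->|_] //= := eqVneq w u; rewrite su !andbF.
rewrite (eq_bigr (fun w => if side w then #|X| else #|Y|)) => [|w /andP[/negPf-> /negPf->]]; last first.
  by case: (side w).
rewrite prod_sides.
have spn : side (pi u) by rewrite sp su.
have -> : #|[set w | (w != u) && (w != pi u) && side w]| = p0.
  rewrite -(card_side1 spn); apply: eq_card => w; rewrite !inE.
  by have [->|_] //= := eqVneq w u; rewrite (negPf su) !andbF.
have -> // : #|[set w | (w != u) && (w != pi u) && ~~ side w]| = q0.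
rewrite -(card_nside1 su); apply: eq_card => w; rewrite !inE.
have [->|_] := eqVneq w (pi u); last by rewrite andbT.
by rewrite spn !andbF.
Qed.

Definition missing (V : finType) (e : rel V) (X Y : {set V}) : {set V * V} :=
  [set xy : V * V | [&& xy.1 \in X, xy.2 \in Y & ~~ e xy.1 xy.2]].

Lemma near_bip_card (C : rat) (V : finType) (e : rel V) X Y : near_bip C e X Y ->
  [/\ (#|X| + #|Y|)%:R <= #|V|%:R :> rat, #|X|%:R <= #|V|%:R :> rat,
      #|Y|%:R <= #|V|%:R :> rat & #|~: (X :|: Y)|%:R <= C].
Proof.
case=> dXY s _ _; have := cardsC (X :|: Y); rewrite cardsU.
have -> : X :&: Y = set0 by apply/eqP; rewrite setI_eq0.
rewrite cards0 subn0 => E; split.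
- by rewrite ler_nat -E leq_addr.
- by rewrite ler_nat max_card.
- by rewrite ler_nat max_card.
- have : (#|X| + #|Y| + #|~: (X :|: Y)|)%:R = #|V|%:R :> rat by rewrite E.
  by rewrite !natrD => E2; move: s; rewrite -E2; set a := _%:R; set b := _%:R; lra.
Qed.

Lemma homs_le_Q (C : rat) : 0 <= C -> exists2 C1 : rat, 0 <= C1 &
  forall (V : finType) (e : rel V) X Y, symmetric e -> near_bip C e X Y ->
  #|homs h e|%:R + #|missing e X Y|%:R * (#|X|%:R ^+ p0 * #|Y|%:R ^+ q0)
   <= QQ #|X|%:R #|Y|%:R + C1 * #|V|%:R ^+ (p0 + q0).+1.
Proof.
move=> C0; exists (#|U|%:R * (#|U|%:R * (4 * C))).
  by rewrite !mulr_ge0 ?ler0n.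
move=> V e X Y e_sym nb; have unc := card_uncrossed C0 nb; have [dXY _ _ _] := nb.
have := homs_near_bip e_sym dXY; set E := [set xy : V * V | _].
have EM : (#|E| + #|missing e X Y| = #|X| * #|Y|)%N.
  rewrite -cardsX -(cardsID [set xy : V * V | e xy.1 xy.2] (setX X Y)).
  congr (_ + _)%N; apply: eq_card => -[x y]; rewrite !inE /= ?andbA //.
  by rewrite andbC andbA.
have {}EM : #|E|%:R = #|X|%:R * #|Y|%:R - #|missing e X Y|%:R :> rat.
  by rewrite -natrM -EM natrD addrK.
rewrite -(ler_nat rat) !natrD !natrM !natrX EM => H.
have U0 : 0 <= #|U|%:R :> rat by apply: ler0n.
have T0 : 0 <= #|V|%:R ^+ (p0 + q0) :> rat by apply: exprn_ge0.
have k := ler_wpM2l U0 (ler_wpM2l U0 (ler_wpM2r T0 unc)).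
have {}H := le_trans H (lerD k (lexx _)).
by move: H; rewrite /Q !exprS; lra.
Qed.

(** By [homs_le_Q], [Q] at the part sizes is nearly [fmax n], of order [n ^ (p + q)], so neither
    part is small. As [Q] cannot exceed [fmax n] by more than lower order, the loss from missing
    pairs is of lower order too, and there are linearly many of them at most. *)
Lemma near_bip_linear (C : rat) : 0 <= C -> exists2 c1 : rat, 0 < c1 <= 1 &
  exists2 C2 : rat, 0 <= C2 & exists n0,
  forall (V : finType) (e : rel V), counterexample e -> (n0 <= #|V|)%N ->
  forall X Y, near_bip C e X Y ->
  [/\ c1 * #|V|%:R <= #|X|%:R, c1 * #|V|%:R <= #|Y|%:R,
      #|missing e X Y|%:R <= C2 * #|V|%:R &
      (f_max #|V|)%:R <= QQ #|X|%:R #|Y|%:R + C2 * #|V|%:R ^+ (p0 + q0).+1].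
Proof.
move=> C0; have [C1 C10 hC1] := homs_le_Q C0.
have [cf cf0 [n0 hcf]] := fmax_ge p0 q0.
have [CA CA0 hCA] := Q_le_fmax p0 q0 0.
(* One factor 2 comes from [Q_le_linear], the other from absorbing [C1]; the cap at 1 is for
   [large_degree]. *)
pose c1 := Num.min (cf / 4) 1.
have c1cf : c1 <= cf / 4 by rewrite ge_min lexx.
have c10 : 0 < c1 by rewrite lt_min divr_gt0.
have c11 : c1 <= 1 by rewrite ge_min lexx orbT.
exists c1; first by rewrite c10.
pose C2 := (CA + C1) / c1 ^+ (p0 + q0) + C1.
have g0 : 0 <= (CA + C1) / c1 ^+ (p0 + q0).
  by apply: divr_ge0; [apply: addr_ge0 | apply: exprn_ge0; apply: ltW].
have C20 : 0 <= C2 by apply: addr_ge0.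
exists C2 => //.
have [n1 hn1] := eventually_ge (2 * C1 / cf).
exists (n0 + n1.+1)%N => V e ge nV; have [nV0 nV1] := leq_addP nV.
have V0 : (0 < #|V|)%N by apply: leq_ltn_trans nV1.
have := hn1 _ (ltnW nV1); rewrite ler_pdivrMr // => nC.
have n_pos : 0 < #|V|%:R :> rat by rewrite ltr0n.
move=> X Y nb; have [es _ _ _ inj_gt] := ge.
have [xyn xn yn _] := near_bip_card nb.
have H := hC1 V e X Y es nb; have F := hcf _ nV0.
have G := hCA #|V| #|X|%:R #|Y|%:R V0 (ler0n _ _) (ler0n _ _) ltac:(by rewrite mulr0n addr0 -natrD).
have fK : (f_max #|V|)%:R <= #|homs h e|%:R :> rat.
  rewrite ler_nat; apply: leq_trans (ltnW inj_gt) _.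
  by apply/subset_leq_card/subsetP => f; rewrite inE => /andP[].
have x0 : 0 <= #|X|%:R :> rat by apply: ler0n.
have y0 : 0 <= #|Y|%:R :> rat by apply: ler0n.
have m0 : 0 <= #|missing e X Y|%:R :> rat by apply: ler0n.
have T0 : 0 < #|V|%:R ^+ (p0 + q0) :> rat by apply: exprn_gt0.
have Qx := Q_le_linear p0 q0 x0 y0 xn yn.
have Qy := Q_le_linear p0 q0 y0 x0 yn xn; rewrite [Q p0 q0 #|Y|%:R _]QC in Qy.
move: (#|X|%:R : rat) (#|Y|%:R : rat) (#|missing e X Y|%:R : rat) (#|homs h e|%:R : rat)
  ((f_max #|V|)%:R : rat) x0 y0 m0 xyn xn yn H F G fK Qx Qy.
move=> x y m K f x0 y0 m0 _ xn yn H F G fK Qx Qy.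
set n := #|V|%:R in n_pos nC xn yn H F G Qx Qy T0 *.
have M0 : 0 <= m * (x ^+ p0 * y ^+ q0) by rewrite !mulr_ge0 ?exprn_ge0.
have nT : 0 < n * n ^+ (p0 + q0) by apply: mulr_gt0.
have low z : QQ x y <= 2 * z * n ^+ (p0 + q0).+1 -> c1 * n <= z.
  move=> Qz; have : (cf * n) * (n * n ^+ (p0 + q0)) <= (2 * z + C1) * (n * n ^+ (p0 + q0)).
    by move: F H Qz; rewrite !exprS; lra.
  rewrite ler_pM2r // => L.
  by apply: le_trans (ler_wpM2r (ltW n_pos) c1cf) _; lra.
have cx := low _ Qx; have cy := low _ Qy.
have fQ : f <= QQ x y + C1 * n ^+ (p0 + q0).+1 by lra.
split => //; last first.
  by apply: le_trans fQ _; rewrite lerD2l ler_wpM2r ?exprn_ge0 ?(ltW n_pos) // lerDr.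
have c0n : 0 <= c1 * n by apply/ltW/mulr_gt0.
have lowT : c1 ^+ (p0 + q0) * n ^+ (p0 + q0) <= x ^+ p0 * y ^+ q0.
  rewrite -exprMn exprD; apply: ler_pM; rewrite ?exprn_ge0 // lerXn2r ?nnegrE //.
have : m * c1 ^+ (p0 + q0) * n ^+ (p0 + q0) <= (CA + C1) * n * n ^+ (p0 + q0).
  have := ler_wpM2l m0 lowT; move: H G; rewrite !exprS; lra.
rewrite ler_pM2r // -ler_pdivlMr ?exprn_gt0 // => H2; apply: le_trans H2 _.
rewrite [X in X <= _](_ : _ = (CA + C1) / c1 ^+ (p0 + q0) * n); last by rewrite mulrAC.
by apply: ler_wpM2r; [apply: ltW | rewrite lerDl].
Qed.

(** Suppose [v] has [a] neighbours in [X], linearly many, and [b] in [Y]. Each of the [a] sees at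
    most [L] of the [b] by [codegree], so [a * (b - L)] pairs are missing, which bounds [b]. By
    [mindeg], [v] has linearly many neighbours on some side. *)
Lemma one_side_few (C : rat) : 0 <= C -> exists2 C3 : rat, 0 <= C3 & exists n0,
  forall (V : finType) (e : rel V), counterexample e -> (n0 <= #|V|)%N ->
  forall X Y, near_bip C e X Y -> forall v,
  #|[set w in Y | e v w]|%:R <= C3 \/ #|[set w in X | e v w]|%:R <= C3.
Proof.
move=> C0; have [c1 _ [C2 C20 [n0 lin]]] := near_bip_linear C0.
have [cd cd0 [n1 hdeg]] := mindeg; have [L L0 [n2 hL]] := codegree.
have [n3 hn3] := eventually_ge (2 * C / cd).
have cd4 : 0 < cd / 4 by rewrite divr_gt0.
exists (L + C2 / (cd / 4)); first by rewrite addr_ge0 // divr_ge0 // ltW.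
exists (n0 + (n1 + (n2 + n3.+1)))%N => V e ge /leq_addP[nV0 /leq_addP[nV1 /leq_addP[nV2 nV3]]].
have n_pos : 0 < #|V|%:R :> rat by rewrite ltr0n; apply: leq_ltn_trans nV3.
have nC := hn3 _ (ltnW nV3); rewrite ler_pdivrMr // in nC.
have [es _ _ _ _] := ge.
have key X Y v : near_bip C e X Y -> cd / 4 * #|V|%:R <= #|[set w in X | e v w]|%:R ->
    #|[set w in Y | e v w]|%:R <= L + C2 / (cd / 4).
  move=> nb big; have [_ _ miss _] := lin V e ge nV0 X Y nb.
  set a := #|[set w in X | _]| in big *; set b := #|[set w in Y | _]|.
  have ab : a%:R * b%:R <= #|missing e X Y|%:R + a%:R * L.
    pose E := [set xy : V * V | (xy.1 \in [set w in X | e v w]) &&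
       ((xy.2 \in [set w in Y | e v w]) && e xy.1 xy.2)].
    have sub : setX [set w in X | e v w] [set w in Y | e v w] \subset missing e X Y :|: E.
      apply/subsetP => -[x y]; rewrite !inE /= => /andP[/andP[-> ->] /andP[-> ->]] /=.
      by case: (e x y).
    have := leq_trans (subset_leq_card sub) (leq_card_setU _ _).
    rewrite cardsX -(ler_nat rat) natrM natrD => H; apply: le_trans H _; rewrite lerD2l.
    rewrite (card_pairs (fun x y => (x \in [set w in X | e v w]) &&
       ((y \in [set w in Y | e v w]) && e x y))) natr_sum.
    rewrite mulr_natl -sumr_const [X in _ <= X]big_mkcond; apply: ler_sum => x _.
    case: ifP => [|xN]; last by rewrite (_ : [set y | _] = set0) ?cards0 //; apply/setP => y; rewrite in_set in_set0.
    rewrite inE => /andP[_ vx]; apply: le_trans (hL V e ge nV2 v x vx).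
    rewrite ler_nat; apply/subset_leq_card/subsetP => y; rewrite !inE.
    by move=> /andP[_ /andP[/andP[_ ->] ->]].
  have [bL|bL] := leP b%:R L; first by apply: le_trans bL _; rewrite lerDl divr_ge0 // ltW.
  have bL0 : 0 <= b%:R - L by rewrite subr_ge0 ltW.
  have := ler_wpM2r bL0 big; move: ab miss; move: (a%:R) (b%:R : rat) => a' b' ab miss H.
  have : (b' - L) * (cd / 4) * #|V|%:R <= C2 * #|V|%:R by lra.
  by rewrite ler_pM2r // -ler_pdivlMr // lerBlDl.
move=> X Y nb v.
have [_ _ _ RC] := near_bip_card nb.
have dv : cd * #|V|%:R <= #|[set w in X | e v w]|%:R + (#|[set w in Y | e v w]|%:R + C).
  apply: le_trans (hdeg V e ge nV1 v) _.
  have sub : [set w | e v w] \subset [set w in X | e v w] :|: ([set w in Y | e v w] :|: ~: (X :|: Y)).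
    by apply/subsetP => w; rewrite !inE => ->; case: (w \in X) (w \in Y) => [] [].
  have := leq_trans (subset_leq_card sub) (leq_trans (leq_card_setU _ _)
    (leq_add (leqnn _) (leq_card_setU _ _))).
  rewrite -(ler_nat rat) !natrD => H; apply: le_trans H _; rewrite !lerD2l.
  exact: RC.
have [bx|bx] := leP (cd / 4 * #|V|%:R) #|[set w in X | e v w]|%:R.
  by left; apply: key bx.
right; apply: (key Y X v (near_bipC nb)).
move: dv nC bx; move: (#|[set w in X | _]|%:R : rat) (#|[set w in Y | _]|%:R : rat) => a b; lra.
Qed.

(** The copies through [v] are bounded below by [mindeg_injs] and above, through [homs_at_near_bip],
    by the degree of [v] into [X] times [S]. Since [Q] is nearly maximal at the part sizes,
    [Q_taylor] controls the difference of its derivatives, and [degree_arith] concludes. *)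
Lemma large_degree (C C3 : rat) : 0 <= C -> 0 <= C3 -> exists n0,
  forall (V : finType) (e : rel V), counterexample e -> (n0 <= #|V|)%N ->
  forall X Y, near_bip C e X Y -> forall v,
  #|[set w in Y | e v w]|%:R <= C3 -> 3 / 4 * #|X|%:R <= #|[set w in X | e v w]|%:R :> rat.
Proof.
move=> C0 C30; have [c1 /andP[c10 c11] [C2 C20 [n0 lin]]] := near_bip_linear C0.
have [CM CM0 [n1 hM]] := mindeg_injs.
have [CA CA0 hCA] := Q_le_fmax p0 q0 0.
pose hh : rat := #|U|%:R.
have hh0 : 0 <= hh by apply: ler0n.
pose C6 := hh * (hh * (C3 + C) + hh * (hh * (4 * C))) + CM.
pose C7 := C2 + CA.
pose c' := c1 ^+ (p0 + q0).
pose P : rat := 2 * p0.+1%:R * q0.+1%:R.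
have P1 : 1 <= P.
  have a1 : 1 <= p0.+1%:R :> rat by rewrite ler1n.
  have a2 : 1 <= q0.+1%:R :> rat by rewrite ler1n.
  have := ler_pM ler01 ler01 a1 a2; rewrite /P; lra.
have P0 : 0 < P by lra.
have c'0 : 0 < c' by apply: exprn_gt0.
have c'1 : c' <= 1 by apply: exprn_ile1 => //; apply: ltW.
(* Prescribed by [degree_arith]; it also satisfies [kap <= c1], so [kap * n] vertices can be moved
   out of [X]. *)
pose kap := c1 * c' / 8 / P.
have k0 : 0 < kap by rewrite !divr_gt0 // mulr_gt0.
have Pk : P * kap = c1 * c' / 8 by rewrite /kap mulrC mulfVK // lt0r_neq0.
have kc : kap <= c1.
  rewrite /kap ler_pdivrMr //.
  have a1 : c1 * c' <= c1 * 1 by rewrite ler_pM2l.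
  have a2 : c1 * 1 <= c1 * P by rewrite ler_pM2l.
  lra.
have [n2 hn2] := eventually_ge (8 / (c1 * c') * (C * hh + C7 / kap + C6) + 1).
exists (n0 + (n1 + n2.+1))%N => V e ge /leq_addP[nV0 /leq_addP[nV1 nV2]].
have V0 : (0 < #|V|)%N by apply: leq_ltn_trans nV2.
have n_pos : 0 < #|V|%:R :> rat by rewrite ltr0n.
have nL : 8 / (c1 * c') * (C * hh + C7 / kap + C6) < #|V|%:R.
  by have := hn2 _ (ltnW nV2); set z := 8 / _ * _; lra.
have [es _ _ _ _] := ge.
move=> X Y nb v few.
have [cx cy _ fQ] := lin V e ge nV0 X Y nb.
have [xyn xn yn RC] := near_bip_card nb; have [dXY sXY _ _] := nb.
have unc := card_uncrossed C0 nb.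
have x0 : 0 <= #|X|%:R :> rat by apply: ler0n.
have y0 : 0 <= #|Y|%:R :> rat by apply: ler0n.
have m1 : #|[set w | e v w && (w \notin X)]|%:R <= C3 + C.
  have sub : [set w | e v w && (w \notin X)] \subset [set w in Y | e v w] :|: ~: (X :|: Y).
    by apply/subsetP => w; rewrite !inE => /andP[-> /negPf->]; case: (w \in Y).
  have := leq_trans (subset_leq_card sub) (leq_card_setU _ _).
  by rewrite -(ler_nat rat) natrD => H; apply: le_trans H _; apply: lerD.
rewrite natrD in xyn.
have TM := hM V e ge nV1 v #|X|%:R #|Y|%:R x0 y0 xyn.
set d := #|[set w in X | e v w]|.
pose x : rat := #|X|%:R; pose y : rat := #|Y|%:R; pose n : rat := #|V|%:R.
pose S := p0.+1%:R * (x ^+ q0 * y ^+ p0) + q0.+1%:R * (x ^+ p0 * y ^+ q0).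
have T0 : 0 < n ^+ (p0 + q0) by apply: exprn_gt0.
have thr : n * (through e v)%:R <= n * d%:R * S +
    hh * (hh * (C3 + C) + hh * (hh * (4 * C))) * (n * n ^+ (p0 + q0)).
  have t1 : n * (through e v)%:R <= \sum_u n * #|homs_at e u v|%:R.
    by rewrite -mulr_sumr ler_wpM2l ?(ltW n_pos) // -natr_sum ler_nat through_le.
  apply: le_trans t1 _.
  pose w u : rat := if side u then x ^+ q0 * y ^+ p0 else x ^+ p0 * y ^+ q0.
  apply: le_trans (_ : \sum_u (n * d%:R * w u +
     (hh * (C3 + C) + hh * (hh * (4 * C))) * (n * n ^+ (p0 + q0))) <= _).
    apply: ler_sum => u _.
    have := homs_at_near_bip u v es dXY; rewrite -(ler_nat rat) !natrD !natrM natrX.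
    have -> : (if side u then (#|X| ^ q0 * #|Y| ^ p0)%N else (#|X| ^ p0 * #|Y| ^ q0)%N)%:R = w u.
      by rewrite /w; case: (side u); rewrite natrM !natrX.
    rewrite -/n -/hh -/d => H; apply: le_trans H _.
    have k1 := ler_wpM2l (ltW n_pos) (ler_wpM2l hh0 (ler_wpM2r (ltW T0) m1)).
    have k2 := ler_wpM2l hh0 (ler_wpM2l hh0 (ler_wpM2r (ltW T0) unc)).
    apply: le_trans (lerD (lerD k1 k2) (lexx _)) _.
    by rewrite -/n le_eqVlt; apply/orP; left; apply/eqP; ring.
  rewrite big_split /= sumr_const -mulr_sumr -[X in _ + X]mulr_natl -/hh mulrA.
  have -> : \sum_u w u = S; last exact: lexx.
  rewrite (bigID side) /= /S; congr (_ + _).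
    rewrite (eq_bigr (fun=> x ^+ q0 * y ^+ p0)) => [|u su]; last by rewrite /w su.
    rewrite sumr_const -cardP mulr_natl; congr (_ *+ _).
    by apply: eq_card => u; rewrite !inE.
  rewrite (eq_bigr (fun=> x ^+ p0 * y ^+ q0)) => [|u su]; last by rewrite /w (negPf su).
  rewrite sumr_const -cardQ mulr_natl; congr (_ *+ _).
  by apply: eq_card => u; rewrite !inE.
have kn0 : 0 <= kap * n by apply/ltW/mulr_gt0.
have knx : kap * n <= x by apply: le_trans cx; rewrite ler_pM2r.
have tay := Q_taylor p0 q0 kn0 knx y0.
(* Moving vertices keeps the sum at most [n], so the new value is at most about [fmax n], hence
   about [Q] at the old sizes. *)
have ytop : Q p0 q0 (x - kap * n) (y + kap * n) <= QQ x y + C7 * (n * n ^+ (p0 + q0)).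
  apply: le_trans (hCA #|V| (x - kap * n) (y + kap * n) V0 _ _ _) _.
  - by rewrite subr_ge0.
  - by apply: addr_ge0.
  - by rewrite mulr0n addr0 -/n; have := xyn; rewrite -/x -/y -/n; set z := kap * n; lra.
  by have := fQ; rewrite -/x -/y -/n /C7 exprS; set z := n * _; lra.
have xyT : (x + y) ^+ (p0 + q0) <= n ^+ (p0 + q0).
  by rewrite lerXn2r ?nnegrE ?addr_ge0 // ltW.
have c1n : 0 <= c1 * n by apply/ltW/mulr_gt0.
have term a b : (a + b = p0 + q0)%N -> c' * n ^+ (p0 + q0) <= x ^+ a * y ^+ b <= n ^+ (p0 + q0).
  move=> E; rewrite /c' -E -exprMn !exprD; apply/andP; split.
    by apply: ler_pM; rewrite ?exprn_ge0 // lerXn2r ?nnegrE.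
  by apply: ler_pM; rewrite ?exprn_ge0 // lerXn2r ?nnegrE // ltW.
have /andP[l1 u1] := term q0 p0 (addnC _ _); have /andP[l2 u2] := term p0 q0 erefl.
have lS : c' * n ^+ (p0 + q0) <= S.
  have a1 : 1 <= p0.+1%:R :> rat by rewrite ler1n.
  have z0 : 0 <= c' * n ^+ (p0 + q0) by rewrite mulr_ge0 // ltW.
  have z1 : 0 <= q0.+1%:R * (x ^+ p0 * y ^+ q0).
    by rewrite mulr_ge0 ?ler0n //; apply: le_trans l2.
  have := ler_pM ler01 z0 a1 l1; rewrite mul1r /S; lra.
have uS : S <= hh * n ^+ (p0 + q0).
  have -> : hh = p0.+1%:R + q0.+1%:R by rewrite /hh card_U -natrD addSn addnS.
  by rewrite mulrDl; apply: lerD; apply: ler_wpM2l; rewrite ?ler0n.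
apply: (degree_arith (n := n) (c := c1) (c' := c') (C := C) (C6 := C6) (C7 := C7)
  (hh := hh) (P := P) (kap := kap) (N := n ^+ (p0 + q0)) (Sy := S)
  (Qx := p0.+1%:R * x ^+ p0 * y ^+ q0.+1 + q0.+1%:R * x ^+ q0 * y ^+ p0.+1)
  (hQ := (p0 + q0).+2%:R * QQ x y) (y := y)) => //.
- by rewrite addr_ge0.
- exact: ltW.
- by move: TM thr; rewrite exprS /C6 -/n -/x -/y; set z := n * n ^+ _; set t := n * _%:R; lra.
- exact: Q_homogeneous_euler.
- have := le_trans tay ytop.
  have Pk0 : 0 <= P * (kap * n) ^+ 2 by rewrite mulr_ge0 ?(ltW P0) // exprn_ge0.
  have := ler_wpM2l Pk0 xyT; rewrite -/P.
  have -> : q0.+1%:R * x ^+ p0.+1 * y ^+ q0 + p0.+1%:R * x ^+ q0.+1 * y ^+ p0 = x * S.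
    by rewrite /S !exprS; ring.
  move: (x * S) (p0.+1%:R * x ^+ p0 * _ + _) (kap * n) (n * _) => a b k z.
  move: (n ^+ _) ((x + y) ^+ _) (QQ x y) => t1 t2 q; lra.
Qed.

Lemma injs_bip_le (V : finType) (e : rel V) (s : pred V) :
  (forall x y, e x y -> s x != s y) ->
  (#|injs h e| <= Phi p0 q0 #|[set x | s x]| #|~: [set x | s x]|)%N.
Proof.
move=> es; set X := [set x | s x].
have sub : injs h e \subset
   [set f : {ffun U -> V} | injectiveb f & [forall u, (f u \in X) == side u]] :|:
   [set f : {ffun U -> V} | injectiveb f & [forall u, (f u \in ~: X) == side u]].
  apply/subsetP => f /injsP[fh /injectiveP fi].
  rewrite in_setU !in_set fi /=.
  have [||H|H] := @two_sides (fun u => f u \in X) (fun u => f u \in ~: X).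
  - move=> u w /fh/es; rewrite !inE.
    by case: (s (f u)) (s (f w)) => [] [].
  - by move=> u; rewrite !inE andbN.
  - apply/orP; left; apply/forallP => u; have := H u; case: ifP => _; first by move->.
    by rewrite inE => /negPf->.
  - apply/orP; right; apply/forallP => u; have := H u; case: ifP => _; first by move->.
    by rewrite in_setC => ->.
apply: leq_trans (subset_leq_card sub) _.
apply: leq_trans (leq_card_setU _ _) _; rewrite /Phi; apply: leq_add.
  by apply: leq_trans (card_inj_sides_le _ _) _; rewrite cardP cardQ.
by apply: leq_trans (card_inj_sides_le _ _) _; rewrite cardP cardQ setCK mulnC.
Qed.

(** Colour a vertex by whether it has few neighbours in [Y]. Adjacent vertices of equal colour would
    each see three quarters of the same part, hence share at least half of it, against [codegree].
    So the whole graph is bipartite, and [injs_bip_le] contradicts the excess of copies. *)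
Lemma no_counterexample : exists n0, forall (V : finType) (e : rel V), (n0 <= #|V|)%N -> ~ counterexample e.
Proof.
have [C C0 [n0 hnb]] := near_bip_exists.
have [C3 C30 [n1 few]] := one_side_few C0.
have [n2 large] := large_degree C0 C30.
have [L L0 [n3 hL]] := codegree.
have [c1 /andP[c10 _] [C2 _ [n4 lin]]] := near_bip_linear C0.
have [n5 hn5] := eventually_ge (2 * (L + 1) / c1).
exists (n0 + (n1 + (n2 + (n3 + (n4 + n5)))))%N => V e.
move=> /leq_addP[nV0 /leq_addP[nV1 /leq_addP[nV2 /leq_addP[nV3 /leq_addP[nV4 nV5]]]]] ge.
have [X [Y nb]] := hnb V e ge nV0.
have nC := hn5 _ nV5; rewrite ler_pdivrMr // in nC.
have no_edge X' Y' v w : near_bip C e X' Y' -> e v w ->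
    #|[set z in Y' | e v z]|%:R <= C3 -> #|[set z in Y' | e w z]|%:R <= C3 -> False.
  move=> nb' vw fv fw; have [cx _ _ _] := lin V e ge nV4 X' Y' nb'.
  have dv := large V e ge nV2 X' Y' nb' v fv; have dw := large V e ge nV2 X' Y' nb' w fw.
  have cod := hL V e ge nV3 v w vw.
  have : (#|[set z in X' | e v z]| + #|[set z in X' | e w z]| <=
          #|X'| + #|[set z | e v z && e w z]|)%N.
    rewrite -cardsUI; apply: leq_add; apply/subset_leq_card/subsetP => z; rewrite !inE.
      by case/orP=> /andP[].
    by move=> /andP[/andP[_ ->] /andP[_ ->]].
  rewrite -(ler_nat rat) !natrD.
  move: cx dv dw cod nC; move: (#|X'|%:R : rat) (#|[set z in X' | e v z]|%:R : rat)
   (#|[set z in X' | e w z]|%:R : rat) (#|[set z | e v z && e w z]|%:R : rat) => a b c' d'.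
  lra.
pose s v := #|[set z in Y | e v z]|%:R <= C3.
have es x y : e x y -> s x != s y.
  move=> xy; apply/negP => /eqP E.
  case sx : (s x); have sy := sx; rewrite E in sy.
    exact: no_edge nb xy sx sy.
  have [|fx] := few V e ge nV1 X Y nb x; first by rewrite -/(s x) sx.
  have [|fy] := few V e ge nV1 X Y nb y; first by rewrite -/(s y) sy.
  exact: no_edge (near_bipC nb) xy fx fy.
have [_ _ _ _] := ge; rewrite ltnNge => /negP; apply.
apply: leq_trans (injs_bip_le es) _.
by apply: leq_trans (Phi_le_fmax _ _ _ _) _; rewrite cardsC.
Qed.

(** * Reduction to large minimum degree *)

Lemma fmax_mono : {homo fmax p0 q0 : m n / (m <= n)%N}.
Proof.
move=> m n; elim: n => [|n IH]; first by rewrite leqn0 => /eqP->.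
rewrite leq_eqVlt => /orP[/eqP-> //|mn]; apply: leq_trans (IH mn) _.
have := fmax_rec p0 q0 n; case: n {IH mn} => [|n].
  (* At [n = 0] the recursion forces [fmax] to vanish. *)
  by rewrite mul0n leqn0 muln_eq0 => /= /eqP->.
move=> H; rewrite -(leq_pmul2l (ltn0Sn n)); apply: leq_trans H.
by rewrite leq_mul2r leq_addr orbT.
Qed.

Section Induced.
Variables (V : finType) (e : rel V) (S : {set V}).
Let e' : rel {x | x \in S} := relpre val e.

Lemma card_induced_injs (T : {set V}) : T \subset S ->
  #|[set f in injs h e | [forall u, f u \in T]]| =
  #|[set f in injs h e' | [forall u, val (f u) \in T]]|.
Proof.
move=> TS; pose j (f : {ffun U -> {x | x \in S}}) := [ffun u => val (f u)].
have jinj : injective j.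
  move=> f g /ffunP E; apply/ffunP => u; apply: val_inj.
  by have := E u; rewrite !ffunE.
rewrite -[RHS](card_imset _ jinj); apply: eq_card => f; apply/idP/imsetP.
  rewrite in_set => /andP[/injsP[fh fi] /forallP fT].
  exists [ffun u => exist _ (f u) (subsetP TS _ (fT u))]; last by apply/ffunP => u; rewrite !ffunE.
  apply/setIdP; split; last by apply/forallP => u; rewrite ffunE /=; apply: fT.
  apply/injsP; split=> [u w uw|u w]; rewrite !ffunE; first by rewrite /e' /= fh.
  by case=> /fi.
case=> g /setIdP[/injsP[gh gi] /forallP gT] ->.
apply/setIdP; split; last by apply/forallP => u; rewrite ffunE.
apply/injsP; split=> [u w uw|u w]; rewrite !ffunE; first exact: gh.
by move/val_inj/gi.
Qed.
End Induced.

(* On a set S maximizing #injs(S) - fmax #|S| + #|S| every vertex lies in nearly as many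
   copies as in an extremal complete bipartite graph, and S is large. *)
Lemma injs_le_fmax : exists n0, forall (V : finType) (e : rel V), (n0 <= #|V|)%N ->
  symmetric e -> irreflexive e -> injs hF e = set0 -> (#|injs h e| <= f_max #|V|)%N.
Proof.
have [n1 ng] := no_counterexample.
exists (n1 + n1 ^ #|U|)%N => V e nV es ei ff; rewrite leqNgt; apply/negP => gt.
pose inS (S : {set V}) := #|[set f in injs h e | [forall u, f u \in S]]|.
(* Adding the constant [f_max #|V|] keeps this natural, and by monotonicity the subtraction is
   exact. *)
pose value S := (inS S + #|S| + (f_max #|V| - f_max #|S|))%N.
have [S _ Smax] := @arg_maxnP {set V} setT xpredT value isT.
have fS (T : {set V}) : (f_max #|T| <= f_max #|V|)%N by apply: fmax_mono; apply: max_card.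
have inT : inS setT = #|injs h e|.
  apply: eq_card => f; rewrite inE; case: (f \in _) => //=.
  by apply/forallP => u; rewrite inE.
have big : (f_max #|S| + #|V| < inS S + #|S|)%N.
  have := Smax setT isT; rewrite /value inT cardsT.
  by move: gt (fS S); clear; move: (f_max _) (f_max _) (inS _) => *; lia.
pose e' : rel {x | x \in S} := relpre val e.
have cardV' : #|{: {x | x \in S}}| = #|S| by rewrite card_sig; apply: eq_card => x; rewrite !inE.
have injs' : inS S = #|injs h e'|.
  rewrite /inS (card_induced_injs e (subxx S)); apply: eq_card => f; rewrite inE.
  by case: (f \in _) => //=; apply/forallP => u; apply: valP.
apply: (ng _ e').
  (* A small [S] carries at most [n1 ^ #|U|] maps, but [big] demands more than [#|V| - #|S|]. *)
  rewrite cardV' leqNgt; apply/negP => Sn1.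
  have : (inS S <= #|S| ^ #|U|)%N.
    by rewrite injs' -cardV' -card_ffun; apply: max_card.
  have : (#|S| ^ #|U| <= n1 ^ #|U|)%N by case: #|U| => // k; rewrite leq_exp2r // ltnW.
  by move: nV big Sn1; clear; move: (f_max _) (inS _) (_ ^ _)%N (_ ^ _)%N => *; lia.
split.
- by move=> x y; apply: es.
- by move=> x; apply: ei.
- apply/setP => f; rewrite [RHS]inE; apply/negP => /injsP[fh fi].
  suff : [ffun w => val (f w)] \in injs hF e by rewrite ff inE.
  apply/injsP; split=> [u w uw|u w]; rewrite !ffunE; first exact: fh.
  by move/val_inj/fi.
- move=> v; rewrite cardV'.
  have Sv : val v \in S by apply: valP.
  have thr : (inS S <= inS (S :\ val v) + through e' v)%N.
    rewrite injs' /inS (card_induced_injs e (subD1set S (val v))) /through.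
    apply: leq_trans _ (leq_card_setU _ _); apply/subset_leq_card/subsetP => f fi.
    rewrite in_setU [f \in _]inE [X in _ || X]inE fi /= orbC -implyNb.
    apply/implyP => /existsPn fv; apply/forallP => u; rewrite in_setD1 (valP (f u)) andbT.
    by rewrite (inj_eq val_inj).
  have := Smax (S :\ val v) isT; rewrite /value.
  have := fS S; have := fS (S :\ val v).
  have := cardsD1 (val v) S; rewrite Sv => -> /=.
  move: thr; clear; move: (inS _) (inS _) (through _ _) (#|_|) (f_max #|V|).
  move=> a b t m f; rewrite add1n /=; move: (f_max _) (f_max _) => *; lia.
rewrite cardV' -injs'; have : (#|S| <= #|V|)%N by apply: max_card.
by move: big; move: (#|S|) (#|V|) (inS _) => m n a; clear; move: (f_max _) => f; lia.
Qed.

End Main.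

Local Open Scope nat_scope.

(** * From homomorphisms to copies *)

Section Copies.
Variables U V : finType.
Variables (H : graph U) (G : graph V).

Definition copy_of (f : {ffun U -> V}) : {set V} * {set {set V}} :=
  (f @: [set: U], [set f @: (d : {set U}) | d in edges H]).

Lemma edgeP (T : finType) (K : graph T) d :
  reflect (exists x y, d = [set x; y] /\ adj K x y) (d \in edges K).
Proof.
apply: (iffP idP) => [dK|[x [y [-> //]]]].
have /cards2P[x [y [_ E]]] := forall_inP (edges_card2 K) d dK.
by exists x, y; rewrite /adj -E.
Qed.

Lemma injs_edge (f : {ffun U -> V}) d :
  f \in homs (adj H) (adj G) -> d \in edges H -> f @: (d : {set U}) \in edges G.
Proof. by move=> /homsP fh /edgeP[x [y [-> /fh]]]; rewrite imsetU1 imset_set1. Qed.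

Lemma copiesP S :
  reflect (exists2 f, f \in injs (adj H) (adj G) & S = copy_of f) (S \in copies H G).
Proof.
rewrite inE; apply: (iffP andP) => [[/andP[/subsetP SG _]]|[f fHG ->]].
  move=> /existsP[f /and3P[/injectiveP fi /eqP S1 /eqP S2]]; exists f.
    apply/injsP; split=> // u w uw; rewrite /adj.
    suff -> : [set f u; f w] = f @: [set u; w] by apply: SG; rewrite S2; apply: imset_f.
    by rewrite imsetU1 imset_set1.
  by case: S S1 S2 {SG} => a b /= -> ->.
have /injsP[_ fi] := fHG; have fh : f \in homs (adj H) (adj G) by move: fHG; rewrite inE => /andP[].
split.
  apply/andP; split; first by apply/subsetP => _ /imsetP[d dH ->]; apply: injs_edge.
  by apply/forall_inP => _ /imsetP[d dH ->]; apply: imsetS; apply: subsetT.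
by apply/existsP; exists f; rewrite !eqxx andbT andbT; apply/injectiveP.
Qed.

Lemma is_free_injs : is_free H G = (injs (adj H) (adj G) == set0).
Proof.
apply/eqP/eqP => E; apply/setP => x; rewrite [RHS]inE; apply/negP => xI.
  have : copy_of x \in copies H G by apply/copiesP; exists x.
  by rewrite E inE.
by have /copiesP[f] := xI; rewrite E inE.
Qed.

(** Embeddings with the same image differ by an automorphism of H, and by finiteness injective
    endomorphisms are automorphisms. *)
Lemma card_copy_fiber f0 : f0 \in injs (adj H) (adj G) ->
  #|[set f in injs (adj H) (adj G) | copy_of f == copy_of f0]| = #|injs (adj H) (adj H)|.
Proof.
move=> f0I; have /injsP[f0h f0i] := f0I.
pose j (s : {ffun U -> U}) := [ffun u => f0 (s u)].
have jinj : injective j.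
  by move=> s t /ffunP E; apply/ffunP => u; have := E u; rewrite !ffunE => /f0i.
have imj (s : {ffun U -> U}) (A : {set U}) : j s @: A = f0 @: (s @: A).
  by rewrite -imset_comp; apply: eq_imset => u; rewrite /= ffunE.
rewrite -(card_imset _ jinj); apply: eq_card => f; apply/setIdP/imsetP.
  move=> [/injsP[fh fi] /eqP E].
  have fE u : exists w, f0 w == f u.
    have : f u \in (copy_of f).1 by apply: imset_f.
    by rewrite E => /imsetP[w _ ->]; exists w.
  pose s := [ffun u => xchoose (fE u)].
  have sE u : f0 (s u) = f u by rewrite ffunE; apply/eqP; apply: (xchooseP (fE u)).
  exists s; last by apply/ffunP => u; rewrite ffunE sE.
  apply/injsP; split=> [u w uw|u w /(congr1 f0)]; last by rewrite !sE => /fi.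
  have : f @: [set u; w] \in (copy_of f).2 by apply: imset_f.
  rewrite E => /imsetP[d dH]; rewrite imsetU1 imset_set1 -!sE => Ed.
  rewrite /adj; suff -> : [set s u; s w] = d by [].
  by apply: (imset_inj f0i); rewrite -Ed imsetU1 imset_set1.
move=> [s /injsP[sh si] ->]; split.
  by apply/injsP; split=> [u w uw|u w]; rewrite !ffunE; [apply: f0h; apply: sh | move/f0i; apply: si].
have sT : s @: [set: U] = [set: U].
  by apply/eqP; rewrite eqEcard subsetT /= card_imset.
have sE : [set s @: (d : {set U}) | d in edges H] = edges H.
  apply/eqP; rewrite eqEcard card_imset ?leqnn ?andbT; last exact: imset_inj.
  apply/subsetP => _ /imsetP[d /edgeP[x [y [-> /sh xy]]] ->].
  by rewrite imsetU1 imset_set1.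
apply/eqP; congr (_, _); first by rewrite imj sT.
rewrite -[in RHS]sE -imset_comp; apply: eq_imset => d; exact: imj.
Qed.

(** The factor is independent of [G], so maximizing copies and maximizing embeddings are the same
    problem. *)
Lemma card_injs_copies :
  #|injs (adj H) (adj G)| = ncopies H G * #|injs (adj H) (adj H)|.
Proof.
rewrite -sum1_card (partition_big copy_of (mem (copies H G))) /=; last first.
  by move=> f fI; apply/copiesP; exists f.
rewrite /ncopies -sum_nat_const; apply: eq_bigr => S /copiesP[f0 f0I ->].
by rewrite sum1dep_card -(card_copy_fiber f0I).
Qed.

Lemma card_aut_gt0 : 0 < #|injs (adj H) (adj H)|.
Proof.
apply/card_gt0P; exists [ffun u => u]; apply/injsP.
by split=> [u w|u w]; rewrite !ffunE.
Qed.
End Copies.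

(** * Graphs from relations, and colourings *)

Lemma adj_neq (V : finType) (G : graph V) x y : adj G x y -> x != y.
Proof. by apply: contraTneq => ->; rewrite adj_irrefl. Qed.

Lemma set2_eq (T : finType) (x y u w : T) :
  [set x; y] = [set u; w] -> x != y -> x = u /\ y = w \/ x = w /\ y = u.
Proof.
move=> E xy; have : x \in [set u; w] by rewrite -E set21.
have : y \in [set u; w] by rewrite -E set22.
rewrite !inE => /orP[/eqP yE|/eqP yE] /orP[/eqP xE|/eqP xE].
- by rewrite xE yE eqxx in xy.
- by right.
- by left.
- by rewrite xE yE eqxx in xy.
Qed.

Lemma graph_of_rel (V : finType) (r : rel V) : symmetric r -> irreflexive r ->
  exists G : graph V, adj G =2 r.
Proof.
move=> rs ri; pose E := [set d : {set V} | [exists x, exists y, r x y && (d == [set x; y])]].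
have E2 : [forall d in E, #|d| == 2].
  apply/forall_inP => d; rewrite inE => /existsP[x /existsP[y /andP[xy /eqP->]]].
  by rewrite cards2; have -> : x != y by apply: contraTneq xy => ->; rewrite ri.
exists (Graph E2) => u w; rewrite /adj /= inE; apply/existsP/idP => [[x /existsP[y]]|uw].
  move=> /andP[xy /eqP E']; have xny : x != y by apply: contraTneq xy => ->; rewrite ri.
  by have [[<- <-]|[<- <-]] := set2_eq (esym E') xny; rewrite // rs.
by exists u; apply/existsP; exists w; rewrite uw /=.
Qed.

Lemma colorable_chi (V : finType) (G : graph V) k : chi G <= k <-> colorable G k.
Proof.
rewrite /chi; case: ex_minnP => m mc mmin; split=> [mk|]; last exact: mmin.
case/existsP: mc => c /forallP cP; apply/existsP; exists [ffun x => widen_ord mk (c x)].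
apply/forallP => x; apply/forallP => y; apply/implyP => xy; rewrite !ffunE.
by have := implyP (forallP (cP x) y) xy; apply: contraNneq => /(congr1 val) /= /val_inj ->.
Qed.

Lemma colorable2P (V : finType) (G : graph V) :
  colorable G 2 <-> exists c : pred V, forall x y, adj G x y -> c x != c y.
Proof.
split=> [/existsP[c /forallP cP]|[c cP]].
  exists (fun x => c x == ord0) => x y xy.
  have := implyP (forallP (cP x) y) xy; apply: contraNN.
  move: (c x) (c y) => [[|[|//]] ?] [[|[|//]] ?] //=.
apply/existsP; exists [ffun x => inord (c x)].
apply/forallP => x; apply/forallP => y; apply/implyP => xy; rewrite !ffunE.
have lt2 (b : bool) : b < 2 by case: b.
apply: contraNneq (cP x y xy) => /(congr1 val) /=; rewrite !inordK ?lt2 //.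
by case: (c x) (c y) => [] [].
Qed.

(** Two-colour F minus [d]. The ends of [d] get equal colours, or F itself would be 2-colourable;
    the colour classes are named so that this colour is [true]. *)
Lemma critical_coloring (W : finType) (F : graph W) d : chi F = 3 -> color_critical F d ->
  exists (c : pred W) w1 w2, [/\ w1 != w2, c w1, c w2 &
   forall u w, adj F u w -> [|| c u != c w, (u == w1) && (w == w2) | (u == w2) && (w == w1)]].
Proof.
move=> F3 /andP[dF]; rewrite F3 ltnS => /colorable_chi/colorable2P[c cP].
have /edgeP[w1 [w2 [dE w12]]] := dF.
have other u w : adj F u w ->
    [|| c u != c w, (u == w1) && (w == w2) | (u == w2) && (w == w1)].
  move=> uw; have [E|E] := eqVneq [set u; w] d.
    rewrite dE in E; have [[-> ->]|[-> ->]] := set2_eq E (adj_neq uw); rewrite !eqxx ?orbT //.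
  by rewrite cP // /adj /= !inE E.
have c12 : c w1 = c w2.
  apply/eqP; apply: contraT => c12.
  suff /colorable_chi : colorable F 2 by rewrite F3.
  apply/colorable2P; exists c => u w /other /or3P[//|/andP[/eqP-> /eqP->] //|].
  by move=> /andP[/eqP-> /eqP->]; rewrite eq_sym.
exists (fun w => c w == c w1), w1, w2; split; rewrite ?eqxx ?c12 //.
  exact: adj_neq w12.
move=> u w /other; case: (c u) (c w) (c w2) => [] [] [] //=.
Qed.

Theorem theorem1 (U W : finType) (H : graph U) (F : graph W) (s t : nat)
    (K : {set U} * {set {set U}}) :
  bipartite H ->
  0 < s -> 0 < t ->
  K \in copies (complete_bipartite s t) H ->
  (forall v : U, exists2 u, u \in K.1 & adj H v u) ->
  chi F = 3 ->
  (exists e : {set W}, color_critical F e) ->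
  weakly_turan_good H F.
Proof.
move=> /colorable2P[col colP] s0 t0 /copiesP[g /injsP[gh gi] KE] domK F3 [d dcrit].
exists 2 => //.
have [c [w1 [w2 [w12 cw1 cw2 Fc]]]] := critical_coloring F3 dcrit.
pose a0 := g (inl (Ordinal s0)); pose b0 := g (inr (Ordinal t0)).
pose A := [set g (inl i) | i in [set: 'I_s]]; pose B := [set g (inr i) | i in [set: 'I_t]].
have AB a b : a \in A -> b \in B -> adj H a b.
  move=> /imsetP[i _ ->] /imsetP[j _ ->]; apply: gh.
  by rewrite /adj /=; apply/imset2P; exists i j.
have a0A : a0 \in A by apply: imset_f.
have b0B : b0 \in B by apply: imset_f.
pose side u := col u == col a0.
have h_side u w : adj H u w -> side u != side w.
  by move=> /colP; rewrite /side; case: (col u) (col w) (col a0) => [] [] [].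
have B_side b : b \in B -> ~~ side b.
  by move=> bB; have := h_side _ _ (AB _ _ a0A bB); rewrite {1}/side eqxx; case: (side b).
have A_side a : a \in A -> side a.
  move=> aA; have := h_side _ _ (AB _ _ aA b0B).
  by rewrite (negPf (B_side _ b0B)); case: (side a).
have dom v : exists u, (u \in A :|: B) && adj H u v.
  have [u uK vu] := domK v; exists u; rewrite adj_sym vu andbT.
  move: uK; rewrite KE /= => /imsetP[[i|i] _ ->]; rewrite inE; apply/orP; [left|right]; exact: imset_f.
pose pi v := xchoose (dom v).
have piAB v : pi v \in A :|: B by have /andP[] := xchooseP (dom v).
have hpi v : adj H (pi v) v by have /andP[] := xchooseP (dom v).
have [p0 cardP] : exists p, #|[set u | side u]| = p.+1.
  exists #|[set u | side u]|.-1; rewrite prednK //; apply/card_gt0P; exists a0.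
  by rewrite inE A_side.
have [q0 cardQ] : exists q, #|[set u | ~~ side u]| = q.+1.
  exists #|[set u | ~~ side u]|.-1; rewrite prednK //; apply/card_gt0P; exists b0.
  by rewrite inE B_side.
have [n1 upper] := injs_le_fmax (adj_sym H) h_side A_side B_side AB hpi piAB a0A b0B
  cardP cardQ Fc w12 cw1 cw2.
have [cf cf0 [n2 lower]] := fmax_ge p0 q0.
exists (n1 + n2.+1) => n /leq_addP[nn1 nn2].
(* Positivity makes both parts of the extremal bipartition nonempty, as a complete 2-partite graph
   requires. *)
have f0 : 0 < fmax p0 q0 n.
  rewrite -(ltr_nat rat); apply: lt_le_trans (lower _ (ltnW nn2)).
  by rewrite mulr_gt0 // exprn_gt0 // ltr0n; apply: leq_ltn_trans nn2.
have [x xn fE] := fmax_attained p0 q0 n.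
pose r : rel 'I_n := fun i j => (i < x) != (j < x).
have rs : symmetric r by move=> i j; rewrite /r eq_sym.
have ri : irreflexive r by move=> i; rewrite /r eqxx.
have [T TE] := graph_of_rel rs ri.
pose X := [set i : 'I_n | i < x].
have cX : #|X| = x.
  have -> : X = [set widen_ord xn i | i in [set: 'I_x]].
    apply/setP => i; rewrite inE; apply/idP/imsetP => [ix|[j _ ->]]; last by rewrite /=.
    by exists (Ordinal ix); rewrite ?inE //; apply: val_inj.
  by rewrite card_imset ?cardsT ?card_ord // => i j /(congr1 val) /= /val_inj.
have cXC : #|~: X| = n - x by rewrite cardsCs setCK cX card_ord.
have x0 : 0 < x.
  by move: f0; rewrite fE /Phi; case: (x) => [|//]; rewrite !ffact0n !mul0n.
have nx0 : 0 < n - x.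
  by move: f0; rewrite fE /Phi; case: (n - x) => [|//]; rewrite !ffact0n !muln0.
have T_free : is_free F T.
  rewrite is_free_injs; apply/eqP/setP => f; rewrite [RHS]inE; apply/negP => /injsP[fh _].
  suff /colorable_chi : colorable F 2 by rewrite F3.
  by apply/colorable2P; exists (fun w => f w < x) => u w /fh; rewrite TE.
(* The two summands of [Phi] count the two orientations of H in [T], which are disjoint because the
   image of [a0] tells them apart. *)
have T_injs : fmax p0 q0 n <= #|injs (adj H) (adj T)|.
  pose S (Z : {set 'I_n}) := [set f : {ffun U -> 'I_n} | injectiveb f & [forall u, (f u \in Z) == side u]].
  have SP Z f : f \in S Z -> injective f /\ forall u, (f u \in Z) = side u.
    by rewrite inE => /andP[/injectiveP fi /forallP fs]; split=> // u; apply/eqP.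
  have dS : S X :&: S (~: X) = set0.
    apply/setP => f; rewrite !inE; apply/negP.
    move=> /andP[/andP[_ /forallP/(_ a0)/eqP E1] /andP[_ /forallP/(_ a0)/eqP E2]].
    by move: E2; rewrite inE E1; case: (side a0).
  have sub : S X :|: S (~: X) \subset injs (adj H) (adj T).
    apply/subsetP => f /setUP[] /SP[fi fs]; apply/injsP; split=> // u w /h_side.
      by rewrite TE /r -!fs !inE.
    by rewrite TE /r -!fs !inE; case: (_ < x) (_ < x) => [] [].
  apply: leq_trans (subset_leq_card sub).
  rewrite cardsU dS cards0 subn0 fE /Phi; apply: leq_add.
    by apply: leq_trans (card_inj_sides_ge _ _); rewrite cX cXC cardP cardQ.
  by apply: leq_trans (card_inj_sides_ge _ _); rewrite setCK cX cXC cardP cardQ mulnC.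
exists T.
  have lt2 (b : bool) : b < 2 by case: b.
  exists (fun i : 'I_n => inord (i < x) : 'I_2); split.
    have n0 : 0 < n by apply: leq_trans x0 xn.
    have xltn : x < n by rewrite -subn_gt0.
    case=> [[|[|//]] i2].
      by exists (Ordinal xltn); apply: val_inj; rewrite /= ltnn inordK.
    by exists (Ordinal n0); apply: val_inj; rewrite /= x0 inordK.
  move=> i j; rewrite TE /r; apply/idP/idP; apply: contraNN => /eqP.
    by move=> /(congr1 val) /=; rewrite !inordK ?lt2 //; case: (i < x) (j < x) => [] [].
  by move->.
apply/eqP; rewrite eqn_leq; apply/andP; split; last first.
  exact: (bigop.leq_bigmax_cond (F := fun G : graph 'I_n => ncopies H G) T T_free).
apply/bigop.bigmax_leqP => G; rewrite is_free_injs => /eqP G_free.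
rewrite -(leq_pmul2r (card_aut_gt0 H)) -!card_injs_copies; apply: leq_trans T_injs.
have := upper _ (adj G); rewrite card_ord; apply=> //; [exact: adj_sym | exact: adj_irrefl].
Qed.
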